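(* Let $r\geq 1$ be an integer and let $Z\subset\mathbb{F}_r$ be a reduced $0$-dimensional subscheme of the Hirzebruch surface $\mathbb{F}_r$. Let $\alpha(mZ)$ denote the initial degree of $mZ$ with respect to $L_r=(r+1)F_r+E_r$. Then the inequality $$\frac{\alpha(mZ)}{m}\geq\frac{\alpha(Z)}{r+2}$$ holds for all integers $m\geq 1$.
   Context: Work over an algebraically closed field. For an integer $r\geq 1$, the Hirzebruch surface $\mathbb{F}_r$ is the projectivization of the vector bundle $\mathcal{O}_{\mathbb{P}^1}\oplus\mathcal{O}_{\mathbb{P}^1}(r)$, with projection $\varphi_r:\mathbb{F}_r\to\mathbb{P}^1$. $F_r$ denotes (the class of) a fiber of $\varphi_r$, and $E_r$ denotes the unique section of $\varphi_r$ with $E_r^2=-r$. The line bundle $L_r=(r+1)F_r+E_r$ is ample. Initial degree: for a reduced subscheme $Z\subset\mathbb{F}_r$ with ideal sheaf $\mathcal{I}_Z$ and an integer $m\geq 1$, the initial degree of $mZ$ with respect to $L_r$ is $\alpha(mZ):=\min\{d : H^0(\mathbb{F}_r; dL_r\otimes\mathcal{I}_Z^m)\neq 0\}$. For a reduced $0$-dimensional $Z$ (a finite set of points) this is the least $d$ such that $|dL_r|$ contains a divisor having multiplicity at least $m$ at every point of $Z$. *)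

(* Defs.v *)
From HB Require Import structures.
From mathcomp Require Import all_boot all_order all_algebra.
From mathcomp Require Import generic_quotient fraction finmap boolp.
From mathcomp Require Export mpoly.

Set Implicit Arguments.
Unset Strict Implicit.
Unset Printing Implicit Defensive.

Import Order.TTheory GRing.Theory Num.Theory.
Local Open Scope ring_scope.
Local Open Scope quotient_scope.

(* The Hirzebruch surface F_r = P(O + O(r)) over P^1.  A quadruple             *)
(* ((x0, x1), (w0, w1)) with (x0, x1) and (w0, w1) nonzero represents the       *)
(* point of the fibre over [x0 : x1] spanned by (w0, w1), where w0 is a         *)
(* coordinate on O and w1 one on O(r); O(r) is trivialised on x_i <> 0 by       *)
(* x_i ^ r, so that quadruples are taken modulo                                 *)
(*   ((x0, x1), (w0, w1)) ~ ((a x0, a x1), (b w0, b a^r w1)).                   *)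
Definition hquad (F : Type) : Type := ((F * F) * (F * F))%type.

Definition hquad_valid (F : fieldType) (q : hquad F) : bool :=
  (q.1 != (0, 0)) && (q.2 != (0, 0)).

Definition torus_act (F : fieldType) (r : nat) (a b : F) (q : hquad F) :
    hquad F :=
  ((a * q.1.1, a * q.1.2), (b * q.2.1, b * a ^+ r * q.2.2)).

(* The four standard affine charts.  The first bit selects x0 <> 0 (false) or   *)
(* x1 <> 0 (true); the second bit selects w1 <> 0 (false) or w0 <> 0 (true).    *)
Definition chart : Type := (bool * bool)%type.

Definition base_den (F : fieldType) (c : chart) (q : hquad F) : F :=
  if c.1 then q.1.2 else q.1.1.

Definition base_num (F : fieldType) (c : chart) (q : hquad F) : F :=
  if c.1 then q.1.1 else q.1.2.

Definition fibre_den (F : fieldType) (c : chart) (q : hquad F) : F :=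
  if c.2 then q.2.1 else q.2.2.

Definition in_chart (F : fieldType) (c : chart) (q : hquad F) : bool :=
  (base_den c q != 0) && (fibre_den c q != 0).

(* The affine coordinates identifying each chart with A^2: a coordinate on the  *)
(* base and one on the fibre.  For false, false they are (x1/x0, w0 x0^r/w1).   *)
Definition chart_coord (F : fieldType) (r : nat) (c : chart) (q : hquad F) :
    F * F :=
  let n := base_den c q in
  (base_num c q / n,
   if c.2 then q.2.2 / (q.2.1 * n ^+ r) else q.2.1 * n ^+ r / q.2.2).

Definition xy (F : Type) (a : F * F) : 'I_2 -> F :=
  fun i => if i == ord0 then a.1 else a.2.

Lemma in_chart_torus (F : fieldType) (r : nat) (a b : F) (c : chart)
    (q : hquad F) (ha : a != 0) (hb : b != 0) :
  in_chart c (torus_act r a b q) = in_chart c q.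
Proof.
by case: c => [[] []]; rewrite /in_chart /base_den /fibre_den /=
  !mulf_eq0 ?expf_eq0 (negPf ha) (negPf hb) ?andbF.
Qed.

Lemma chart_coord_torus (F : fieldType) (r : nat) (a b : F) (c : chart)
    (q : hquad F) (ha : a != 0) (hb : b != 0) :
  chart_coord r c (torus_act r a b q) = chart_coord r c q.
Proof.
have har : a ^+ r != 0 by rewrite expf_neq0.
case: c => [c1 c2]; rewrite /chart_coord /=; congr (_, _).
  by case: c1; rewrite /base_den /base_num /= -mulf_div divff // mul1r.
have -> : base_den (c1, c2) (torus_act r a b q) = a * base_den (c1, c2) q.
  by rewrite /base_den /=; case: c1.
rewrite exprMn; case: c2; rewrite mulrACA -mulf_div divff ?mul1r //
  mulf_neq0 //.
Qed.

(* Closed points of F_r; k being algebraically closed, they are k-rational.     *)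
Definition hquad_pt (k : fieldType) : Type := {q : hquad k | hquad_valid q}.
HB.instance Definition _ (k : fieldType) := Choice.on (hquad_pt k).

Definition same_point (k : fieldType) (r : nat) (p q : hquad_pt k) : bool :=
  `[< exists a b : k,
        [/\ a != 0, b != 0 & val q = torus_act r a b (val p)] >].

Lemma same_point_equiv (k : fieldType) (r : nat) :
  equiv_class_of (@same_point k r).
Proof.
split=> [p|p q|q p s].
- apply/asboolP; exists 1, 1; rewrite !oner_neq0; split=> //.
  by case: (val p) => [[? ?] [? ?]]; rewrite /torus_act /= expr1n !mul1r.
- have sym (u v : hquad_pt k) : same_point r u v -> same_point r v u.
    move=> /asboolP[a [b [ha hb e]]]; apply/asboolP; exists a^-1, b^-1.
    rewrite !invr_neq0 //; split=> //; rewrite e.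
    have har : a ^+ r != 0 by rewrite expf_neq0.
    case: (val u) => [[? ?] [? ?]]; rewrite /torus_act /= !mulKf //.
    by rewrite exprVn -invfM mulKf // mulf_neq0.
  by apply/idP/idP; apply: sym.
- move=> /asboolP[a [b [ha hb e]]] /asboolP[a' [b' [ha' hb' e']]].
  apply/asboolP; exists (a' * a), (b' * b); rewrite !mulf_neq0 //; split=> //.
  rewrite e' e; case: (val q) => [[? ?] [? ?]]; rewrite /torus_act /= !mulrA.
  by rewrite exprMn; congr (_, (_, _ * _)); rewrite mulrACA !mulrA.
Qed.

Canonical same_point_equivRel (k : fieldType) (r : nat) :=
  EquivRelPack (same_point_equiv k r).

Definition hirzebruch (k : fieldType) (r : nat) : Type :=
  {eq_quot (@same_point_equivRel k r)}.
HB.instance Definition _ (k : fieldType) (r : nat) :=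
  Choice.on (hirzebruch k r).

(* Homogeneous coordinates of a point; by the two lemmas _torus nothing below   *)
(* depends on the chosen representative.                                        *)
Definition hcoord (k : fieldType) (r : nat) (p : hirzebruch k r) : hquad k :=
  val (repr (p : {eq_quot (@same_point_equivRel k r)})).

(* The function field k(t, u) of F_r, and the generic point, for which          *)
(* t = x1 / x0 and u = w0 x0^r / w1.                                            *)
Notation funfield k := {fraction {mpoly k[2]}}.

Definition generic_pt (k : fieldType) : hquad (funfield k) :=
  ((1, tofrac ('X_(ord0 : 'I_2))), (tofrac ('X_(ord_max : 'I_2)), 1)).

Definition const_fun (k : fieldType) (a : k) : funfield k :=
  tofrac (a%:MP : {mpoly k[2]}).
HB.instance Definition _ (k : fieldType) :=
  GRing.RMorphism.copy (@const_fun k) (@tofrac {mpoly k[2]} \o @mpolyC 2 k).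

(* The coordinate ring of each chart is k[x, y]; this is its inclusion in the   *)
(* function field.                                                              *)
Definition chart_fun (k : fieldType) (r : nat) (c : chart)
    (f : {mpoly k[2]}) : funfield k :=
  mmap (@const_fun k) (xy (chart_coord r c (generic_pt k))) f.
HB.instance Definition _ (k : fieldType) (r : nat) (c : chart) :=
  GRing.RMorphism.copy (@chart_fun k r c)
    (mmap (@const_fun k) (xy (chart_coord r c (generic_pt k)))).

(* A local equation on each chart of the divisor a F + b E, where F is the      *)
(* fibre x0 = 0 and E is the section w0 = 0.  On E the fibre coordinates        *)
(* w0 x0^r / w1 and w0 x1^r / w1 differ by the factor (x1 / x0)^r, so the       *)
(* normal bundle of E is O(-r), i.e. E^2 = - r.                                 *)
Definition divisor_eq (k : fieldType) (r a b : nat) (c : chart) : funfield k :=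
  let z := chart_coord r c (generic_pt k) in
  (if c.1 then z.1 ^+ a else 1) * (if c.2 then 1 else z.2 ^+ b).

Definition ideal_pow (A : comNzRingType) (I : A -> Prop) (m : nat) (f : A) :
    Prop :=
  exists (n : nat) (h : 'I_n -> A) (g : 'I_n -> 'I_m -> A),
    (forall i j, I (g i j)) /\ f = \sum_(i < n) h i * \prod_(j < m) g i j.

(* Sections over a chart of the ideal sheaf of the reduced subscheme Z.         *)
Definition ideal_of (k : fieldType) (r : nat) (Z : {fset hirzebruch k r})
    (c : chart) (f : {mpoly k[2]}) : Prop :=
  forall p : hirzebruch k r, p \in Z -> in_chart c (hcoord p) ->
    f.@[xy (chart_coord r c (hcoord p))] = 0.

(* The rational functions g in H^0(F_r, O(aF + bE) (x) I_Z^m), where O(D) is    *)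
(* the subsheaf of the function field generated on each chart by the inverse    *)
(* of the local equation of D.                                                  *)
Definition H0 (k : fieldType) (r a b : nat) (Z : {fset hirzebruch k r})
    (m : nat) (g : funfield k) : Prop :=
  forall c : chart, exists f : {mpoly k[2]},
    ideal_pow (ideal_of Z c) m f /\ divisor_eq k r a b c * g = chart_fun r c f.

(* H^0(F_r, d L_r (x) I_Z^m) <> 0 for L_r = (r+1) F + E.                        *)
Definition has_section (k : fieldType) (r : nat) (Z : {fset hirzebruch k r})
    (m d : nat) : Prop :=
  exists g : funfield k, g != 0 /\ H0 (d * r.+1) d Z m g.

(* The equation of the fibre through p, in the chart c.                         *)
Definition fibre_eq (k : fieldType) (r : nat) (c : chart)
    (p : hirzebruch k r) : {mpoly k[2]} :=
  let q := (hcoord p).1 in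
  if c.1 then q.2%:MP * 'X_ord0 - q.1%:MP else q.2%:MP - q.1%:MP * 'X_ord0.

Lemma ideal_of_fibre_eq (k : fieldType) (r : nat) (Z : {fset hirzebruch k r})
    (c : chart) :
  ideal_of Z c (\prod_(p <- Z) fibre_eq c p).
Proof.
move=> p pZ /andP[n0 _]; rewrite rmorph_prod /= (big_fsetD1 p) //=.
suff -> : (fibre_eq c p).@[xy (chart_coord r c (hcoord p))] = 0 by rewrite mul0r.
move: n0; rewrite /fibre_eq /chart_coord /base_den /base_num.
case: c => [[] c2] /= n0; rewrite mevalB mevalM !mevalC mevalXU /xy /=.
  by rewrite mulrCA divff // mulr1 subrr.
by rewrite mulrCA divff // mulr1 subrr.
Qed.

Lemma has_section_exists (k : fieldType) (r : nat) (Z : {fset hirzebruch k r})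
    (m : nat) :
  exists d, has_section Z m d.
Proof.
pose d := (size (Z : seq (hirzebruch k r)) * m)%N; exists d.
pose t : funfield k := tofrac ('X_(ord0 : 'I_2)).
have t0 : t != 0.
  rewrite /t tofrac_eq0; apply/eqP => /(congr1 (mcoeff U_(ord0))) /eqP.
  by rewrite mcoeffXU eqxx mcoeff0 oner_eq0.
pose K : k -> funfield k := @const_fun k.
pose gp (p : hirzebruch k r) := K (hcoord p).1.2 - K (hcoord p).1.1 * t.
have KE (c : chart) (a : k) : chart_fun r c a%:MP = K a by rewrite /chart_fun mmapC.
have XE (c : chart) (i : 'I_2) : chart_fun r c 'X_i = xy (chart_coord r c (generic_pt k)) i.
  by rewrite /chart_fun mmapX mmap1U.
pose z c := (chart_coord r c (generic_pt k)).1.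
have zE c : z c = if c.1 then t^-1 else t.
  by case: c => [[] c2]; rewrite /z /chart_coord /base_den /base_num /= ?mul1r ?divr1.
have fE c p : chart_fun r c (fibre_eq c p) = (if c.1 then z c else 1) * gp p.
  rewrite /fibre_eq /gp; case: c => [[] c2] /=.
    rewrite rmorphB rmorphM /= !KE XE /xy eqxx -/(z (true, c2)) zE /= mulrBr.
    by congr (_ - _); [exact: mulrC | rewrite mulrCA mulVf // mulr1].
  by rewrite rmorphB rmorphM /= !KE XE /xy eqxx -/(z (false, c2)) zE /= mul1r.
exists ((\prod_(p <- Z) gp p) ^+ m); split.
  rewrite expf_neq0 //; rewrite prodf_seq_neq0; apply/allP => p _ /=.
  have : hquad_valid (hcoord p) by exact: valP (repr _).
  have -> : gp p = tofrac ((hcoord p).1.2%:MP - (hcoord p).1.1%:MP * 'X_ord0).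
    by rewrite rmorphB rmorphM.
  rewrite tofrac_eq0 => /andP[/eqP n0 _].
  apply/eqP => gp0; apply: n0.
  have ev v : (hcoord p).1.2 - (hcoord p).1.1 * v = 0.
    have /(congr1 (meval (fun=> v))) :
      (hcoord p).1.2%:MP - (hcoord p).1.1%:MP * 'X_ord0 = 0 :> {mpoly k[2]}.
      exact: gp0.
    by rewrite mevalB mevalM !mevalC mevalXU => ->.
  have b0 : (hcoord p).1.2 = 0 by have := ev 0; rewrite mulr0 subr0.
  have a0 : (hcoord p).1.1 = 0.
    by apply/eqP; have /eqP := ev 1; rewrite b0 mulr1 sub0r oppr_eq0.
  by rewrite [LHS]surjective_pairing a0 b0.
move=> c.
pose e := if c.1 then (d * r.+1 - d)%N else 0%N.
pose e' := if c.2 then 0%N else d.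
exists ('X_ord0 ^+ e * 'X_ord_max ^+ e' * (\prod_(p <- Z) fibre_eq c p) ^+ m).
split.
  exists 1%N, (fun=> 'X_ord0 ^+ e * 'X_ord_max ^+ e'),
    (fun _ _ => \prod_(p <- Z) fibre_eq c p).
  split; first by move=> *; exact: ideal_of_fibre_eq.
  by rewrite big_ord1 prodr_const card_ord.
rewrite !rmorphM !rmorphXn /= rmorph_prod /= !XE.
rewrite (eq_bigr _ (fun p _ => fE c p)).
rewrite big_split /= big_const_seq count_predT iter_mulr_1 (exprMn m) -exprM -[(_ * m)%N]/d.
rewrite mulrA; congr (_ * _); rewrite {}/e {}/e' /divisor_eq.
have -> : xy (chart_coord r c (generic_pt k)) ord0 = z c by [].
set w := (chart_coord r c (generic_pt k)).2.
have -> : xy (chart_coord r c (generic_pt k)) ord_max = w by [].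
rewrite -/(z c); move: (z c) w => v w.
case: c.1; case: c.2; rewrite ?expr1n ?expr0 ?mul1r ?mulr1 //.
  by rewrite -exprD subnK ?leq_pmulr.
by rewrite mulrAC -exprD subnK ?leq_pmulr.
Qed.

(* The initial degree alpha(mZ); no negative d can occur, L_r being ample.      *)
Definition initial_degree (k : fieldType) (r : nat)
    (Z : {fset hirzebruch k r}) (m : nat) : nat :=
  @ex_minn (fun d => `[< has_section Z m d >])
    (let: ex_intro d hd := has_section_exists Z m in
     ex_intro _ d (asboolT hd)).

Lemma initial_degreeP (k : fieldType) (r : nat) (Z : {fset hirzebruch k r})
    (m : nat) :
  has_section Z m (initial_degree Z m) /\
  forall d, has_section Z m d -> (initial_degree Z m <= d)%N.
Proof.
rewrite /initial_degree; case: ex_minnP => d /asboolP hd min; split=> // d' hd'.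
by apply: min; apply/asboolP.
Qed.

(* Main.v *)
(* Let a = alpha(Z) > 0 and let G in |d L| have multiplicity m along Z.  As no
   curve of |(a-1)L| contains Z, some N = h^0((a-1)L) points p_j of Z are
   unisolvent for |(a-1)L|, with a dual basis s_j.  Given q, some s_j does not
   vanish at q, and multiplying it by a section of L vanishing at p_j but not at q
   shows that the curves of |aL| through the p_j have no other base point, so that
   one of them, C, has no component in common with G.  Bezout then gives
   m a^2 <= m N <= G . C = (r+2) a d, that is m a <= (r+2) d.

   The Bezout inequality is a dimension count in H^0(nL), n large: forms
   X G + Y C have the Koszul relations as only syzygies, while modulo m-jets at
   the p_j they contribute only Y C, which depends on the (m-1)-jet of Y. *)

From HB Require Import structures.
Require Import Defs.
From mathcomp Require Import all_boot all_order all_algebra finmap fraction ring zify.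
Import Order.TTheory GRing.Theory Num.Theory.
Local Open Scope ring_scope.

Set Implicit Arguments.
Unset Strict Implicit.
Unset Printing Implicit Defensive.

(** * Bivariate polynomials with staircase support *)

(** The constant [r + 2] is the self-intersection of L, and it enters as the mixed second difference
    of the quadratic function s -> h^0(sL). No intersection multiplicity is ever defined: Bezout is
    replaced by the injectivity of a single linear map, and the multiplicity m at a point appears as
    the difference between the number of conditions for order m and for order m - 1.

    The obstacle is that G may have fixed or multiple components, so the second curve must be chosen
    against G. Degree a - 1 cannot supply it, since no nonzero section of (a-1)L vanishes at all the
    p_j; degree a leaves just enough freedom.

    Sections are handled as polynomials in the affine coordinates t, u with restricted support. Such
    a polynomial does not see the section u = oo and the fibre x0 = 0, so divisibility and
    coprimality need separate conditions along these two curves. *)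

Section Staircase.
Variable k : fieldType.
Implicit Types (f g : {poly {poly k}}) (w : nat -> nat).

(** A Newton polygon: [l] is the exponent of the outer variable, [j] that of the inner one.
    Trapezoids ([w] increasing) give the spaces of sections, and the triangle [w l = m - l] gives
    the jets modulo order [m]. *)
Definition supported (B : nat) w f :=
  forall l j, ~~ ((l < B) && (j < w l))%N -> f`_l`_j = 0.

Definition bimono (p : nat * nat) : {poly {poly k}} := 'X^(p.1) *: 'X^(p.2).

Lemma coef_bimono p l j :
  (bimono p)`_l`_j = ((l == p.2) && (j == p.1))%:R.
Proof.
rewrite /bimono coefZ coefXn; case: eqP => _ /=; rewrite ?mulr1 ?mulr0 ?coef0 //.
by rewrite coefXn.
Qed.

Lemma bimonoM p q : bimono p * bimono q = bimono (p.1 + q.1, p.2 + q.2)%N.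
Proof. by rewrite /bimono -scalerAl -scalerAr scalerA -!exprD. Qed.

Lemma bipolyP f g : (forall l j, f`_l`_j = g`_l`_j) -> f = g.
Proof. by move=> fg; apply/polyP => l; apply/polyP. Qed.

Lemma supported_size B w f : supported B w f -> (size f <= B)%N.
Proof.
move=> sf; apply/leq_sizeP => l Bl; apply/polyP => j; rewrite coef0.
by apply: sf; rewrite ltnNge Bl.
Qed.

Lemma supported_sum B w f : supported B w f ->
  f = \sum_(l < B) \sum_(j < w l) (f`_l`_j)%:P *: bimono (j : nat, l : nat).
Proof.
move=> sf; apply: bipolyP => l j; rewrite coef_sum coef_sum.
have E (l' : 'I_B) :
    ((\sum_(j' < w l') (f`_l'`_j')%:P *: bimono (j' : nat, l' : nat))`_l)`_j =
    if (l == l' :> nat) && (j < w l)%N then f`_l`_j else 0.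
  rewrite coef_sum coef_sum.
  under eq_bigr => j' _ do rewrite coefZ mul_polyC coefZ coef_bimono /=.
  case: eqP => [->|_] /=; last by rewrite big1 // => j' _; rewrite mulr0.
  case: ltnP => wj.
    rewrite (bigD1 (Ordinal wj)) //= eqxx mulr1 big1 ?addr0 // => j' nj.
    by rewrite eq_sym (negPf (_ : j' != j :> nat)) ?mulr0.
  by rewrite big1 // => j' _; rewrite gtn_eqF ?mulr0 // (leq_trans _ wj).
under eq_bigr do rewrite E.
case: (ltnP l B) => lB; last first.
  rewrite big1 => [|l' _]; first by apply: sf; rewrite ltnNge lB.
  by rewrite gtn_eqF //= (leq_trans _ lB).
rewrite (bigD1 (Ordinal lB)) //= eqxx /= big1 ?addr0.
  by case: ltnP => // wj; apply: sf; rewrite lB ltnNge wj.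
by move=> l' nl; rewrite eq_sym (negPf (_ : l' != l :> nat)).
Qed.

(** Induction over monomials; it reduces the identities between polynomials and forms below to
    bookkeeping of exponents. *)
Lemma supportedP B w (P : {poly {poly k}} -> Prop) :
    P 0 -> (forall f g, P f -> P g -> P (f + g)) ->
    (forall c p, (p.2 < B)%N -> (p.1 < w p.2)%N -> P (c%:P *: bimono p)) ->
  forall f, supported B w f -> P f.
Proof.
move=> P0 PD Pm f /supported_sum ->; elim/big_ind: _ => // l _.
by elim/big_ind: _ => // j _; apply: Pm => /=.
Qed.

Lemma supported0 B w : supported B w 0.
Proof. by move=> l j _; rewrite !coef0. Qed.

Lemma supportedD B w f g :
  supported B w f -> supported B w g -> supported B w (f + g).
Proof. by move=> sf sg l j h; rewrite !coefD sf ?sg ?addr0. Qed.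

Lemma supportedZ B w c f : supported B w f -> supported B w (c%:P *: f).
Proof. by move=> sf l j h; rewrite coefZ mul_polyC coefZ sf ?mulr0. Qed.

Lemma supportedN B w f : supported B w f -> supported B w (- f).
Proof. by move=> sf l j h; rewrite !coefN sf ?oppr0. Qed.

Lemma supported_bimono B w p :
  (p.2 < B)%N -> (p.1 < w p.2)%N -> supported B w (bimono p).
Proof.
move=> h1 h2 l j; rewrite coef_bimono.
by case: eqP => [->|//]; case: eqP => [->|//]; rewrite h1 h2.
Qed.

Lemma supported_sumr B w (I : Type) (s : seq I) (P : pred I) (F : I -> {poly {poly k}}) :
  (forall i, P i -> supported B w (F i)) -> supported B w (\sum_(i <- s | P i) F i).
Proof.
move=> sF; elim/big_ind: _ => //; [exact: supported0 | exact: supportedD].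
Qed.

Definition staircase (B : nat) w : seq (nat * nat) :=
  [seq (j, l) | l <- iota 0 B, j <- iota 0 (w l)].

Lemma mem_staircase B w p :
  (p \in staircase B w) = (p.2 < B)%N && (p.1 < w p.2)%N.
Proof.
apply/allpairsPdep/andP => [[l [j []]]|[h1 h2]].
  by rewrite !mem_iota !add0n => h1 h2 ->.
by exists p.2, p.1; rewrite !mem_iota !add0n h1 h2; case: p {h1 h2}.
Qed.

Lemma staircase_uniq B w : uniq (staircase B w).
Proof.
apply: allpairs_uniq_dep => [|l _|]; rewrite ?iota_uniq //.
by move=> [l j] [l' j'] _ _ /= [-> ->].
Qed.

Lemma size_staircase B w : size (staircase B w) = (\sum_(l < B) w l)%N.
Proof.
rewrite size_allpairs_dep sumnE big_map -[B in iota 0 B]subn0 -/(index_iota 0 B) big_mkord.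
by apply: eq_bigr => l _; rewrite size_iota.
Qed.

(** Row vectors indexed by the staircase turn spaces of sections and of jets into a [vectType] whose
    dimension is a number of lattice points. *)
Definition of_coords B w (v : 'rV[k]_(size (staircase B w))) : {poly {poly k}} :=
  \sum_i (v 0 i)%:P *: bimono (nth (0, 0)%N (staircase B w) i).

Definition coords B w f : 'rV[k]_(size (staircase B w)) :=
  \row_i f`_(nth (0, 0)%N (staircase B w) i).2`_(nth (0, 0)%N (staircase B w) i).1.

Lemma of_coordsK B w : cancel (@of_coords B w) (@coords B w).
Proof.
move=> v; apply/rowP => i; rewrite mxE coef_sum coef_sum.
under eq_bigr => i' _ do rewrite coefZ mul_polyC coefZ coef_bimono.
rewrite (bigD1 i) //= !eqxx mulr1 big1 ?addr0 // => i' ni.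
case: andP => [[/eqP h1 /eqP h2]|_]; last by rewrite mulr0.
case/negP: ni; apply/eqP/val_inj/eqP.
rewrite /= -(nth_uniq (0, 0)%N (ltn_ord i') (ltn_ord i) (staircase_uniq _ _)).
by rewrite [X in X == _]surjective_pairing -h1 -h2 -surjective_pairing.
Qed.

Lemma of_coords_supported B w v : supported B w (@of_coords B w v).
Proof.
apply: supported_sumr => i _; apply/supportedZ.
have : nth (0, 0)%N (staircase B w) i \in staircase B w by apply: mem_nth.
by rewrite mem_staircase => /andP[h1 h2]; apply: supported_bimono.
Qed.

Lemma coordsK B w f : supported B w f -> of_coords (coords B w f) = f.
Proof.
move=> sf; apply: bipolyP => l j.
case: (boolP ((l < B) && (j < w l))%N) => [h|h]; last first.
  by rewrite sf //; apply: of_coords_supported.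
have pin : (j, l) \in staircase B w by rewrite mem_staircase.
have /rowP /(_ (Ordinal (etrans (index_mem _ _) pin))) := of_coordsK (coords B w f).
by rewrite !mxE /= nth_index.
Qed.

Lemma coords_eq0 B w f : supported B w f -> coords B w f = 0 -> f = 0.
Proof.
move=> sf f0; rewrite -(coordsK sf) f0 /of_coords big1 // => i _.
by rewrite mxE scale0r.
Qed.

Lemma coords_linear B w c f g :
  coords B w (c%:P *: f + g) = c *: coords B w f + coords B w g.
Proof. by apply/rowP => i; rewrite !mxE !coefD coefZ mul_polyC coefZ. Qed.

Lemma of_coords_linear B w c u v :
  @of_coords B w (c *: u + v) = c%:P *: of_coords u + of_coords v.
Proof.
rewrite /of_coords scaler_sumr -big_split /=; apply: eq_bigr => i _.
by rewrite scalerA -scalerDl !mxE -polyCM -polyCD.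
Qed.

End Staircase.

(** * Sections on the Hirzebruch surface *)

Section Sections.
Variables (k : fieldType) (r : nat).
Implicit Types f g : {poly {poly k}}.

(* The inner variable of f is t = x1 / x0 and the outer one u = w0 x0^r / w1:
   [sect s B] is H^0((s + r B) F + B E), written in the chart (false, false), so
   that [sect e e] is H^0(e L_r). *)
Definition sect (s B : nat) f := supported B.+1 (fun l => (s + r * l).+1)%N f.

Lemma sectM s B s' B' f g :
  sect s B f -> sect s' B' g -> sect (s + s') (B + B') (f * g).
Proof.
move=> sf sg; move: f sf; apply: supportedP => [|f f' hf hf'|c p pB pw].
- by rewrite mul0r; apply: supported0.
- by rewrite mulrDl; apply: supportedD.
rewrite -scalerAl; apply: supportedZ; move: g sg.
apply: supportedP => [|f f' hf hf'|c' p' pB' pw'].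
- by rewrite mulr0; apply: supported0.
- by rewrite mulrDr; apply: supportedD.
rewrite -scalerAr; apply: supportedZ; rewrite bimonoM.
apply: supported_bimono => /=; first lia.
by rewrite !ltnS in pw pw' *; rewrite mulnDr addnACA leq_add.
Qed.

Lemma sect1 : sect 0 0 1.
Proof.
have -> : 1 = bimono k (0, 0)%N by rewrite /bimono !expr0 scale1r.
exact: supported_bimono.
Qed.

Lemma sectX s B f n : sect s B f -> sect (s * n) (B * n) (f ^+ n).
Proof.
move=> sf; elim: n => [|n IHn]; first by rewrite !muln0; apply: sect1.
by rewrite exprS !mulnS; apply: sectM.
Qed.

Lemma sect_prod s B n (F : 'I_n -> {poly {poly k}}) :
  (forall i, sect s B (F i)) -> sect (s * n) (B * n) (\prod_i F i).
Proof.
elim: n F => [|n IHn] F sF; first by rewrite big_ord0 !muln0; apply: sect1.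
by rewrite big_ord_recl !mulnS; apply: sectM => //; apply: IHn.
Qed.

Section Eval.
Variable A : comNzRingType.
Implicit Types (K : k -> A) (q : hquad A).

(* The bihomogeneous form in the Cox coordinates ((x0, x1), (w0, w1)) attached
   to f; it is multiplicative only on [sect]. *)
Definition heval K s B f q : A :=
  \sum_(l < B.+1) \sum_(j < (s + r * l).+1) K f`_l`_j *
    (q.1.1 ^+ (s + r * l - j) * q.1.2 ^+ j * (q.2.1 ^+ l * q.2.2 ^+ (B - l))).

Lemma eq_heval K K' s B f q : K =1 K' -> heval K s B f q = heval K' s B f q.
Proof.
by move=> KK; apply: eq_bigr => l _; apply: eq_bigr => j _; rewrite KK.
Qed.

Variable K : {rmorphism k -> A}.

Lemma hevalD s B f g q : heval K s B (f + g) q = heval K s B f q + heval K s B g q.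
Proof.
rewrite /heval -big_split /=; apply: eq_bigr => l _; rewrite -big_split /=; apply: eq_bigr => j _.
by rewrite !coefD rmorphD mulrDl.
Qed.

Lemma hevalZ s B c f q : heval K s B (c%:P *: f) q = K c * heval K s B f q.
Proof.
rewrite /heval mulr_sumr; apply: eq_bigr => l _; rewrite mulr_sumr; apply: eq_bigr => j _.
by rewrite coefZ mul_polyC coefZ rmorphM -mulrA.
Qed.

Lemma heval0 s B q : heval K s B 0 q = 0.
Proof. by rewrite -(scale0r (0%:P : {poly {poly k}})) -polyC0 hevalZ rmorph0 mul0r. Qed.

Lemma hevalN s B f q : heval K s B (- f) q = - heval K s B f q.
Proof. by apply/eqP; rewrite -addr_eq0 -hevalD addNr heval0. Qed.

Lemma heval_sum s B (I : Type) (t : seq I) (P : pred I) (F : I -> {poly {poly k}}) q :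
  heval K s B (\sum_(i <- t | P i) F i) q = \sum_(i <- t | P i) heval K s B (F i) q.
Proof.
apply: (big_morph (fun f => heval K s B f q)); last exact: heval0.
by move=> *; apply: hevalD.
Qed.

Lemma heval_bimono s B p q : (p.2 <= B)%N -> (p.1 <= s + r * p.2)%N ->
  heval K s B (bimono k p) q =
  q.1.1 ^+ (s + r * p.2 - p.1) * q.1.2 ^+ p.1 * (q.2.1 ^+ p.2 * q.2.2 ^+ (B - p.2)).
Proof.
move=> h1 h2; have h1' : (p.2 < B.+1)%N by [].
have h2' : (p.1 < (s + r * (Ordinal h1')).+1)%N by [].
rewrite /heval (bigD1 (Ordinal h1')) //= (bigD1 (Ordinal h2')) //=.
rewrite coef_bimono !eqxx rmorph1 mul1r !big1 ?addr0 // => [l nl|j nj].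
  rewrite big1 // => j _; rewrite coef_bimono (negPf (_ : l != p.2 :> nat)) //.
  by rewrite rmorph0 mul0r.
by rewrite coef_bimono (negPf (_ : j != p.1 :> nat)) // andbF rmorph0 mul0r.
Qed.

Lemma hevalM s B s' B' f g q : sect s B f -> sect s' B' g ->
  heval K (s + s') (B + B') (f * g) q = heval K s B f q * heval K s' B' g q.
Proof.
move=> sf sg; move: f sf; apply: supportedP => [|f f' hf hf'|c p pB pw].
- by rewrite mul0r !heval0 mul0r.
- by rewrite mulrDl !hevalD mulrDl hf hf'.
rewrite -scalerAl !hevalZ -mulrA; congr (_ * _); move: g sg.
apply: supportedP => [|f f' hf hf'|c' p' pB' pw'].
- by rewrite mulr0 !heval0 mulr0.
- by rewrite mulrDr !hevalD mulrDr hf hf'.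
rewrite -scalerAr !hevalZ mulrCA; congr (_ * _); rewrite bimonoM.
rewrite !ltnS in pB pB' pw pw'.
have pq : (p.1 + p'.1 <= s + s' + r * (p.2 + p'.2))%N.
  by rewrite mulnDr addnACA leq_add.
rewrite !heval_bimono //= ?leq_add //.
have -> : (s + s' + r * (p.2 + p'.2) - (p.1 + p'.1) =
  (s + r * p.2 - p.1) + (s' + r * p'.2 - p'.1))%N.
  by rewrite mulnDr; lia.
have -> : (B + B' - (p.2 + p'.2) = (B - p.2) + (B' - p'.2))%N by lia.
by rewrite !exprD; ring.
Qed.

Lemma heval1 q : heval K 0 0 1 q = 1.
Proof.
have -> : 1 = bimono k (0, 0)%N by rewrite /bimono !expr0 scale1r.
by rewrite heval_bimono //= add0n muln0 !expr0 !mulr1.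
Qed.

Lemma hevalX s B f n q : sect s B f ->
  heval K (s * n) (B * n) (f ^+ n) q = heval K s B f q ^+ n.
Proof.
move=> sf; elim: n => [|n IHn]; first by rewrite !muln0 expr0 heval1.
by rewrite !exprS !mulnS hevalM ?IHn //; apply: sectX.
Qed.

Lemma heval_prod s B n (F : 'I_n -> {poly {poly k}}) q : (forall i, sect s B (F i)) ->
  heval K (s * n) (B * n) (\prod_i F i) q = \prod_i heval K s B (F i) q.
Proof.
elim: n F => [|n IHn] F sF; first by rewrite !big_ord0 !muln0 heval1.
by rewrite !big_ord_recl !mulnS hevalM ?IHn //; apply: sect_prod.
Qed.

End Eval.

(** All monomials of the form have the same weights: [w1] has weight [r] in [a], so its exponent
    [B - l] makes up for the [r * l] in the exponents on the base. *)
Lemma heval_torus (F : fieldType) (K : k -> F) s B f a b q :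
  heval K s B f (torus_act r a b q) = a ^+ (s + r * B) * b ^+ B * heval K s B f q.
Proof.
rewrite /heval mulr_sumr; apply: eq_bigr => l _; rewrite mulr_sumr; apply: eq_bigr => j _.
have lB : (l <= B)%N by rewrite -ltnS.
have js : (j <= s + r * l)%N by rewrite -ltnS.
have -> : a ^+ (s + r * B) = a ^+ (s + r * l - j) * a ^+ j * (a ^+ r) ^+ (B - l).
  by rewrite -exprM -!exprD subnK // mulnBr -addnA subnKC // leq_mul.
have -> : b ^+ B = b ^+ l * b ^+ (B - l) by rewrite -exprD subnKC.
rewrite /torus_act /= !exprMn; move: (_ ^+ (B - l)) => e1; ring.
Qed.


Lemma rmorph_heval (A A' : comNzRingType) (h : {rmorphism A -> A'}) (K : k -> A)
    s B f (q : hquad A) :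
  h (heval K s B f q) =
  heval (h \o K) s B f ((h q.1.1, h q.1.2), (h q.2.1, h q.2.2)).
Proof.
rewrite /heval rmorph_sum; apply: eq_bigr => l _; rewrite rmorph_sum; apply: eq_bigr => j _.
by rewrite !rmorphM /= !rmorphXn.
Qed.

End Sections.

(** * Orders of vanishing and syzygies *)

Section Order.
Variable k : fieldType.
Implicit Types f g : {poly {poly k}}.

Definition ord_ge (m : nat) f := forall l j, (l + j < m)%N -> f`_l`_j = 0.

Lemma bicoefM f g l j : (f * g)`_l`_j =
  \sum_(a < l.+1) \sum_(b < j.+1) f`_a`_b * g`_(l - a)`_(j - b).
Proof. by rewrite coefM coef_sum; apply: eq_bigr => a _; rewrite coefM. Qed.

Lemma ord_ge0 m : ord_ge m 0.
Proof. by move=> l j _; rewrite !coef0. Qed.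

Lemma ord_geD m f g : ord_ge m f -> ord_ge m g -> ord_ge m (f + g).
Proof. by move=> hf hg l j h; rewrite !coefD hf ?hg ?addr0. Qed.

Lemma ord_geN m f : ord_ge m f -> ord_ge m (- f).
Proof. by move=> hf l j h; rewrite !coefN hf ?oppr0. Qed.

Lemma ord_ge_sum m (I : Type) (s : seq I) (P : pred I) (F : I -> {poly {poly k}}) :
  (forall i, P i -> ord_ge m (F i)) -> ord_ge m (\sum_(i <- s | P i) F i).
Proof. by move=> hF; elim/big_ind: _; [exact: ord_ge0 | exact: ord_geD |]. Qed.

Lemma ord_geM m n f g : ord_ge m f -> ord_ge n g -> ord_ge (m + n) (f * g).
Proof.
move=> hf hg l j h; rewrite bicoefM big1 // => a _; rewrite big1 // => b _.
have := ltn_ord a; have := ltn_ord b; rewrite !ltnS => hb ha.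
case: (ltnP (a + b) m) => hab; first by rewrite hf ?mul0r.
by rewrite hg ?mulr0 //; lia.
Qed.

Lemma ord_geMl m f g : ord_ge m g -> ord_ge m (f * g).
Proof. by move=> hg; rewrite -[m]add0n; apply: ord_geM => // l j. Qed.

Lemma ord_ge_prod m (F : 'I_m -> {poly {poly k}}) :
  (forall i, ord_ge 1 (F i)) -> ord_ge m (\prod_i F i).
Proof.
elim: m F => [|m IHm] F hF; first by move=> l j.
by rewrite big_ord_recl; apply: (@ord_geM 1 m) => //; apply: IHm.
Qed.

Lemma ord_ge_exp m f : ord_ge 1 f -> ord_ge m (f ^+ m).
Proof.
by move=> hf; rewrite -[m in _ ^+ m]card_ord -prodr_const; apply: ord_ge_prod.
Qed.

Lemma ord_ge1 f : f`_0`_0 = 0 -> ord_ge 1 f.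
Proof. by move=> f0 [|l] [|j]. Qed.

(** A power series with nonzero constant term is a unit. Concretely, by induction on [l + j], every
    term of the coefficient of [g * f] other than [g]_0[_0 * f]_l[_j] contains a coefficient of [f]
    of smaller total degree. *)
Lemma ord_ge_unit m f g : g`_0`_0 != 0 -> ord_ge m (g * f) -> ord_ge m f.
Proof.
move=> g0 hgf l j; move: {2}(l + j)%N (leqnn (l + j)) => n.
elim/ltn_ind: n l j => n IHn l j le_n lt_m.
have := hgf l j lt_m; rewrite bicoefM big_ord_recl /= big_ord_recl /= !subn0.
rewrite big1 ?addr0 => [|b _]; last first.
  have := ltn_ord b; rewrite ?/bump /= ?add1n ?subn0 => hb.
  rewrite (IHn (l + (j - b.+1))%N) ?mulr0 //; lia.
rewrite big1 ?addr0 => [/eqP|a _].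
  by rewrite mulf_eq0 (negPf g0) => /eqP.
rewrite big1 // => b _; have := ltn_ord b; have := ltn_ord a.
rewrite /bump /= add1n => ha hb.
rewrite (IHn (l - a.+1 + (j - b))%N) ?mulr0 //; lia.
Qed.

Lemma ord_ge_supported m f :
  supported m (fun l => m - l)%N f -> ord_ge m f -> f = 0.
Proof.
move=> sf hf; apply: bipolyP => l j; rewrite !coef0.
case: (ltnP (l + j) m) => h; first exact: hf.
by apply: sf; lia.
Qed.

Lemma ord_ge_coords m f : coords m (fun l => m - l)%N f = 0 -> ord_ge m f.
Proof.
move=> /rowP f0 l j h.
have pin : (j, l) \in staircase m (fun l => m - l)%N.
  by rewrite mem_staircase /=; lia.
have := f0 (Ordinal (etrans (index_mem _ _) pin)).
by rewrite !mxE /= nth_index.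
Qed.

End Order.

(** * Syzygies of two curves without common component *)

Section Syzygy.
Variable k : closedFieldType.
Implicit Types (f G C X Y U V : {poly {poly k}}) (t : k).

Definition fibre t f : {poly k} := map_poly (horner_eval t) f.
HB.instance Definition _ t := GRing.RMorphism.copy (fibre t) (map_poly (horner_eval t)).

Lemma coef_fibre t f l : (fibre t f)`_l = (f`_l).[t].
Proof. by rewrite coef_map. Qed.

Lemma fibre_polyC t (c : {poly k}) : fibre t c%:P = (c.[t])%:P.
Proof. by rewrite /fibre map_polyC. Qed.

Lemma fibre_eq0 t f : fibre t f = 0 -> exists g, f = ('X - t%:P)%:P * g.
Proof.
move=> f0; exists (\poly_(i < size f) (f`_i %/ ('X - t%:P))).
apply/polyP => i; rewrite coefCM coef_poly; case: ltnP => hi.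
  rewrite mulrC divpK // dvdp_XsubCl; apply/rootP.
  by rewrite -coef_fibre f0 coef0.
by rewrite mulr0 nth_default.
Qed.

(** The witness is the resultant in the outer variable. As neither leading coefficient vanishes at
    [t0], it commutes with evaluation there, and the coprime fibres make its value nonzero. A curve
    of outer degree zero serves as its own [b]. *)
Lemma bezout_fibre G C t0 : (lead_coef G).[t0] != 0 -> (lead_coef C).[t0] != 0 ->
    coprimep (fibre t0 G) (fibre t0 C) ->
  exists b : {poly k}, b != 0 /\ exists u v, b%:P = u * G + v * C.
Proof.
move=> lG lC cop.
have nz f : (lead_coef f).[t0] != 0 -> f != 0.
  by apply: contraNneq => ->; rewrite lead_coef0 horner0.
case: (leqP (size G) 1) => [/size1_polyC e|sG].
  exists G`_0; split; last by exists 1, 0; rewrite mul1r mul0r addr0.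
  by move: (nz _ lG); rewrite {1}e polyC_eq0.
case: (leqP (size C) 1) => [/size1_polyC e|sC].
  exists C`_0; split; last by exists 0, 1; rewrite mul1r mul0r add0r.
  by move: (nz _ lC); rewrite {1}e polyC_eq0.
have [[u v] /= _ e] := resultant_in_ideal sG sC.
exists (resultant G C); split; last by exists u, v.
have : horner_eval t0 (resultant G C) != 0.
  rewrite map_resultant // resultant_eq0 -leqNgt.
  by move: cop; rewrite coprimep_def => /eqP ->.
by apply: contraNneq => ->; rewrite rmorph0.
Qed.

(* The factor b is removed one root at a time: modulo t - t1, one of the two
   curves does not vanish identically, so V is divisible by t - t1. *)
Lemma syzygy_descent G C X Y :
    (forall t, fibre t G != 0 \/ fibre t C != 0) ->
  forall (b : {poly k}) V, b != 0 -> b%:P * X = C * V -> b%:P * Y = - (G * V) ->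
  exists U, X = C * U /\ Y = - (G * U).
Proof.
move=> GC b; move: {2}(size b) (leqnn (size b)) => n.
elim: n b => [|n IHn] b sb V b0 eX eY.
  by case/negP: b0; rewrite -size_poly_leq0.
case: (leqP (size b) 1) => [/size1_polyC e|b1].
  have c0 : b`_0 != 0 by move: b0; rewrite {1}e polyC_eq0.
  have cK : (b`_0)^-1%:P%:P * b%:P = 1 :> {poly {poly k}}.
    by rewrite [in X in _ * X]e -!polyCM mulVf.
  exists ((b`_0)^-1%:P%:P * V); split.
    by rewrite -[LHS]mul1r -cK -mulrA eX mulrCA.
  by rewrite -[LHS]mul1r -cK -mulrA eY mulrN mulrCA.
have /closed_rootP[t rt] : size b != 1 by rewrite gtn_eqF.
have V0 : fibre t V = 0.
  have bt : fibre t b%:P = 0 by rewrite fibre_polyC (rootP rt).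
  have := congr1 (fibre t) eX; have := congr1 (fibre t) eY.
  rewrite rmorphN !rmorphM /= bt !mul0r => /esym/eqP.
  rewrite oppr_eq0 mulf_eq0 => h1 /esym/eqP; rewrite mulf_eq0 => h2.
  by case: (GC t) => /negPf nsections; [move: h1 | move: h2]; rewrite nsections => /= /eqP.
have [V' eV] := fibre_eq0 V0; have /factor_theorem [b' eb] := rt.
have t0 : ('X - t%:P)%:P != 0 :> {poly {poly k}} by rewrite polyC_eq0 polyXsubC_eq0.
have b'0 : b' != 0 by apply: contraNneq b0 => h; rewrite eb h mul0r.
apply: (IHn b' _ V' b'0).
- by move: sb; rewrite eb size_Mmonic ?monicXsubC // size_XsubC addn2.
- apply: (mulfI t0); rewrite mulrA -polyCM [_ * b']mulrC -eb eX eV; ring.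
- apply: (mulfI t0); rewrite mulrA -polyCM [_ * b']mulrC -eb eY eV; ring.
Qed.

(** From [b = u G + v C] and [X G = - Y C] one gets [b X = C V] and [b Y = - G V] with
    [V = v X - u Y]: the relation is Koszul up to the factor [b], which the descent removes. *)
Lemma syzygy G C X Y t0 :
    (lead_coef G).[t0] != 0 -> (lead_coef C).[t0] != 0 ->
    coprimep (fibre t0 G) (fibre t0 C) ->
    (forall t, fibre t G != 0 \/ fibre t C != 0) ->
    X * G + Y * C = 0 ->
  exists U, X = C * U /\ Y = - (G * U).
Proof.
move=> lG lC cop GC /eqP; rewrite addr_eq0 => /eqP e.
have [b [b0 [u [v eb]]]] := bezout_fibre lG lC cop.
apply: (syzygy_descent GC (V := v * X - u * Y) b0); rewrite eb.
  have -> : (u * G + v * C) * X = u * (X * G) + v * C * X by ring.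
  rewrite e; ring.
have -> : (u * G + v * C) * Y = u * G * Y + v * (Y * C) by ring.
have -> : Y * C = - (X * G) by rewrite e opprK.
ring.
Qed.

Lemma avoid_seq (s : seq k) : exists t, t \notin s.
Proof.
have /closed_nonrootP[t] : \prod_(a <- s) ('X - a%:P) != 0 :> {poly k}.
  by rewrite monic_neq0 // monic_prod_XsubC.
by rewrite root_prod_XsubC => h; exists t.
Qed.

End Syzygy.

Section LinearAlgebra.
Variable K : fieldType.

(** The linear left inverse is what later recovers [U] from [C U]; the inequality of dimensions is
    the final count. *)
Lemma injective_dim (aT rT : vectType K) (f : aT -> rT) :
    (forall c u v, f (c *: u + v) = c *: f u + f v) ->
    (forall u, f u = 0 -> u = 0) ->
  (\dim {:aT} <= \dim {:rT})%N /\
  exists g : rT -> aT, (forall c u v, g (c *: u + v) = c *: g u + g v) /\ cancel f g.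
Proof.
move=> fl fi.
pose fL := GRing.isLinear.Build K aT rT *:%R f fl.
pose F : {linear aT -> rT} := HB.pack f fL.
have kF : lker (linfun F) == 0%VS.
  apply/lker0P => u v; rewrite !lfunE /= => uv.
  apply/eqP; rewrite -subr_eq0; apply/eqP/fi.
  by have := raddfB F u v; rewrite /= => ->; rewrite uv subrr.
split.
  have := limg_dim_eq (f := linfun F) (U := fullv); rewrite (eqP kF) capv0.
  by move=> <- //; apply/dimvS/subvf.
exists ((linfun F)^-1)%VF; split=> [c u v|u]; first by rewrite linearP.
by have := lker0_compVf kF => /lfunP /(_ u); rewrite comp_lfunE !lfunE.
Qed.

End LinearAlgebra.

(** * Charts *)

(* The point with affine coordinates (x, y) in the chart c, a section of
   [chart_coord]. *)
Definition chart_quad (A : nzRingType) (c : chart) (x y : A) : hquad A :=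
  ((if c.1 then (x, 1) else (1, x)), (if c.2 then (1, y) else (y, 1))).

Definition torus_equiv (F : fieldType) (r : nat) (q q' : hquad F) : Prop :=
  exists a b : F, [/\ a != 0, b != 0 & q' = torus_act r a b q].

(** The division by [base_den c q ^+ r] when [w1] is the denominator undoes the factor [a ^+ r] with
    which the torus acts on [w1]. *)
Lemma torus_chart_quad (F : fieldType) r c (q : hquad F) : in_chart c q ->
  q = torus_act r (base_den c q)
        (if c.2 then fibre_den c q else fibre_den c q / base_den c q ^+ r)
        (chart_quad c (chart_coord r c q).1 (chart_coord r c q).2).
Proof.
case: c q => [c1 c2] [[x0 x1] [w0 w1]].
rewrite /in_chart /torus_act /chart_quad /chart_coord /base_num /base_den /fibre_den /=.
case: c1; case: c2 => /= /andP[h1 h2];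
  have h3 := expf_neq0 r h1;
  congr ((_, _), (_, _)); rewrite ?mulr1 //; by field; rewrite ?h1 ?h2 ?h3.
Qed.

Lemma valid_in_chart (F : fieldType) (q : hquad F) :
  hquad_valid q -> exists c, in_chart c q.
Proof.
case: q => [[x0 x1] [w0 w1]] /andP[/= hx hw].
have [c1 h1] : exists c1 : bool, (if c1 then x1 else x0) != 0.
  move: hx; case: (eqVneq x0 0) => [->|]; last by exists false.
  by case: (eqVneq x1 0) => [->|]; [rewrite eqxx | exists true].
have [c2 h2] : exists c2 : bool, (if c2 then w0 else w1) != 0.
  move: hw; case: (eqVneq w1 0) => [->|]; last by exists false.
  by case: (eqVneq w0 0) => [->|]; [rewrite eqxx | exists true].
by exists (c1, c2); rewrite /in_chart /base_den /fibre_den /= h1 h2.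
Qed.

Lemma torus_equiv_chart_coord (F : fieldType) r c (q q' : hquad F) :
  in_chart c q -> in_chart c q' -> chart_coord r c q = chart_coord r c q' ->
  torus_equiv r q q'.
Proof.
have tq (p : hquad F) : in_chart c p -> exists a b, [/\ a != 0, b != 0 &
    p = torus_act r a b (chart_quad c (chart_coord r c p).1 (chart_coord r c p).2)].
  move=> hp; have e := torus_chart_quad r hp; case/andP: hp => h1 h2.
  exists (base_den c p),
    (if c.2 then fibre_den c p else fibre_den c p / base_den c p ^+ r).
  split=> //.
  by case: ifP => // _; rewrite mulf_neq0 ?invr_neq0 ?expf_neq0.
move=> /tq [a [b [a0 b0 eq]]] /tq [a' [b' [a'0 b'0 eq']]] e.
exists (a' / a), (b' / b); rewrite !mulf_neq0 ?invr_neq0 //; split=> //.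
rewrite eq' eq -e; move: (chart_quad _ _ _) => z; rewrite /torus_act /=.
have := expf_neq0 r a0; rewrite exprMn exprVn.
move: (a ^+ r) (a' ^+ r) => ar a'r h3.
by congr ((_, _), (_, _)); field; rewrite ?h3 ?b0 ?a0.
Qed.

Section ChartSections.
Variables (k : fieldType) (r : nat).
Notation sect := (@sect k r).
Notation heval := (@heval k r).

(* The sections of L_r which are 1, x and y in the coordinates (x, y) of the
   chart c; chart_unit c vanishes exactly off that chart. *)
Definition chart_unit (c : chart) : {poly {poly k}} :=
  bimono k (if c.1 then 1 + r * c.2 else 0, c.2 : nat)%N.
Definition chart_x (c : chart) : {poly {poly k}} :=
  bimono k (if c.1 then r * c.2 else 1, c.2 : nat)%N.
Definition chart_y (c : chart) : {poly {poly k}} :=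
  bimono k (if c.1 then 1 + r * ~~ c.2 else 0, ~~ c.2 : nat)%N.

Lemma sect_chart_unit c : sect 1 1 (chart_unit c).
Proof. by case: c => [[] []]; apply: supported_bimono => //=; lia. Qed.
Lemma sect_chart_x c : sect 1 1 (chart_x c).
Proof. by case: c => [[] []]; apply: supported_bimono => //=; lia. Qed.
Lemma sect_chart_y c : sect 1 1 (chart_y c).
Proof. by case: c => [[] []]; apply: supported_bimono => //=; lia. Qed.

Section Values.
Variables (A : comNzRingType) (K : {rmorphism k -> A}) (c : chart).

Lemma heval_chart_unit q :
  heval K 1 1 (chart_unit c) q =
  (if c.1 then q.1.2 else q.1.1) ^+ (1 + r * c.2) * (if c.2 then q.2.1 else q.2.2).
Proof.
case: c => [[] []]; rewrite heval_bimono //=; try lia;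
  rewrite ?subnn ?subn0 ?expr0 ?expr1 ?mul1r ?mulr1 //.
Qed.

Lemma heval_chart_unit_quad x y : heval K 1 1 (chart_unit c) (chart_quad c x y) = 1.
Proof. by rewrite heval_chart_unit; case: c => [[] []]; rewrite /= expr1n mulr1. Qed.

Lemma heval_chart_x x y : heval K 1 1 (chart_x c) (chart_quad c x y) = x.
Proof.
case: c => [[] []]; rewrite heval_bimono //=; try lia;
  rewrite ?expr1n ?addnK ?expr0 ?expr1 ?mul1r ?mulr1 //.
Qed.

Lemma heval_chart_y x y : heval K 1 1 (chart_y c) (chart_quad c x y) = y.
Proof.
case: c => [[] []]; rewrite heval_bimono //=; try lia;
  rewrite ?subnn ?subn0 ?expr1n ?expr0 ?expr1 ?mul1r ?mulr1 //.
Qed.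
End Values.

Lemma heval_chart_eq0 s B f c (q : hquad k) : in_chart c q ->
  (heval idfun s B f q == 0) =
  (heval idfun s B f (chart_quad c (chart_coord r c q).1 (chart_coord r c q).2) == 0).
Proof.
move=> hq; rewrite {1}(torus_chart_quad r hq) heval_torus.
case/andP: hq => h1 h2; rewrite !mulf_eq0 !expf_eq0 (negPf h1) andbF /=.
case: ifP => _; first by rewrite (negPf h2) andbF.
by rewrite mulf_eq0 (negPf h2) invr_eq0 expf_eq0 (negPf h1) !andbF.
Qed.

Lemma heval_chart_unit_neq0 c (q : hquad k) :
  (heval idfun 1 1 (chart_unit c) q != 0) = in_chart c q.
Proof.
by rewrite heval_chart_unit mulf_eq0 expf_eq0 negb_or add1n.
Qed.

(** Take a chart around [q']. If [q] lies off it, the chart unit separates; otherwise one of the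
    affine coordinates differs at the two points, and [x - x(q)] or [y - y(q)] is a section of L. *)
Lemma separation (q q' : hquad k) : hquad_valid q' -> ~ torus_equiv r q q' ->
  exists l, [/\ sect 1 1 l, heval idfun 1 1 l q = 0 & heval idfun 1 1 l q' != 0].
Proof.
move=> /valid_in_chart [c hc'] nt.
case: (boolP (in_chart c q)) => hc; last first.
  exists (chart_unit c); rewrite heval_chart_unit_neq0; split=> //; first exact: sect_chart_unit.
  by apply/eqP; rewrite -[_ == _]negbK heval_chart_unit_neq0.
pose z := chart_coord r c q; pose z' := chart_coord r c q'.
have nz : z <> z' by move=> e; apply: nt; apply: torus_equiv_chart_coord e.
have se (h : {poly {poly k}}) a : sect 1 1 h -> sect 1 1 (h - a%:P *: chart_unit c).
  by move=> sh; apply: supportedD => //; apply/supportedN/supportedZ/sect_chart_unit.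
have ev (h : {poly {poly k}}) a x y :
   heval idfun 1 1 (h - a%:P *: chart_unit c) (chart_quad c x y) =
   heval idfun 1 1 h (chart_quad c x y) - a.
  by rewrite hevalD hevalN hevalZ heval_chart_unit_quad mulr1.
case: (eqVneq z.1 z'.1) => [e1|n1].
  exists (chart_y c - (z.2)%:P *: chart_unit c); split.
  - by apply/se/sect_chart_y.
  - by apply/eqP; rewrite (heval_chart_eq0 _ _ _ hc) ev heval_chart_y subrr.
  rewrite (heval_chart_eq0 _ _ _ hc') ev heval_chart_y subr_eq0 -/z'.
  apply: contra_notN nz => /eqP e2; rewrite [z]surjective_pairing e1 -e2.
  by rewrite -surjective_pairing.
exists (chart_x c - (z.1)%:P *: chart_unit c); split.
- by apply/se/sect_chart_x.
- by apply/eqP; rewrite (heval_chart_eq0 _ _ _ hc) ev heval_chart_x subrr.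
by rewrite (heval_chart_eq0 _ _ _ hc') ev heval_chart_x subr_eq0 eq_sym.
Qed.

Definition coef2 : k -> {poly {poly k}} := polyC \o polyC.
HB.instance Definition _ := GRing.RMorphism.copy coef2 (polyC \o polyC).

(** The local equation of [f] in the chart [c], translated so that the point with coordinates [z]
    becomes the origin; [ord_ge] then measures the multiplicity at that point. *)
Definition taylor c (z : k * k) s B f : {poly {poly k}} :=
  heval coef2 s B f (chart_quad c (coef2 z.1 + 'X%:P) (coef2 z.2 + 'X)).

Lemma taylor_coef0 c z s B f :
  (taylor c z s B f)`_0`_0 = heval idfun s B f (chart_quad c z.1 z.2).
Proof.
rewrite -!horner_coef0 -!/(horner_eval _ _).
rewrite -[LHS]/((horner_eval 0 \o horner_eval 0) _) rmorph_heval.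
rewrite (eq_heval _ _ _ _ _ (K' := idfun)) => [|a]; last first.
  by rewrite /= /horner_eval !hornerC.
congr (heval _ _ _ _ _).
have ex : horner_eval 0 (horner_eval 0 (coef2 z.1 + 'X%:P)) = z.1.
  by rewrite /= /horner_eval !hornerE.
have ey : horner_eval 0 (horner_eval 0 (coef2 z.2 + 'X)) = z.2.
  by rewrite /= /horner_eval !hornerE.
by rewrite /chart_quad; case: c => [[] []]; rewrite /= ex ey !rmorph1.
Qed.

End ChartSections.

(** * The auxiliary curve *)

Section Unisolvent.
Variables (k : fieldType) (r : nat).
Notation sect := (@sect k r).
Notation ev s B f q := (@heval k r k idfun s B f q).

Definition nsections s B : nat := size (staircase B.+1 (fun l => (s + r * l).+1)%N).

(** The matrix of values of the monomials at the points has trivial kernel, hence contains an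
    invertible square block of rows: these rows are the [p j], and the inverse of the block gives
    the dual basis [e]. *)
Lemma unisolvent n (Z : 'I_n -> hquad k) s B :
    (forall f, sect s B f -> (forall i, ev s B f (Z i) = 0) -> f = 0) ->
  exists (p : 'I_(nsections s B) -> 'I_n) (e : 'I_(nsections s B) -> {poly {poly k}}),
    [/\ forall j, sect s B (e j),
        forall i j, ev s B (e j) (Z (p i)) = (i == j)%:R &
        forall f, sect s B f -> f = \sum_j (ev s B f (Z (p j)))%:P *: e j].
Proof.
move=> inj; pose st := staircase B.+1 (fun l => (s + r * l).+1)%N.
pose M : 'M[k]_(n, nsections s B) := \matrix_(i, j) ev s B (bimono k (nth (0, 0)%N st j)) (Z i).
have evM v i : ev s B (of_coords v) (Z i) = (M *m v^T) i 0.
  rewrite heval_sum mxE; apply: eq_bigr => j _.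
  by rewrite hevalZ !mxE mulrC.
have fM : row_full M.
  rewrite -[row_full M]/(\rank M == _) -mxrank_tr; apply: inj_row_free => v vM.
  have v0 : of_coords v = 0 :> {poly {poly k}}.
    apply: inj => [|i]; first exact: of_coords_supported.
    by rewrite evM -[M]trmxK -trmx_mul vM mxE mxE.
  by rewrite -[v]of_coordsK v0; apply/rowP => j; rewrite !mxE !coef0.
pose p := fullrankfun fM; pose M' := rowsub p M.
have uM : M' \in unitmx := fullrowsub_unit fM.
have evM' v i : ev s B (of_coords v) (Z (p i)) = (M' *m v^T) i 0.
  by rewrite evM !mxE; apply: eq_bigr => j _; rewrite !mxE.
pose e j := of_coords (row j (invmx M')^T : 'rV_(size st)).
have ee i j : ev s B (e j) (Z (p i)) = (i == j)%:R.
  by rewrite evM' tr_row trmxK colE mulmxA mulmxV // mul1mx !mxE eqxx andbT.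
exists p, e; split=> // [j|f sf]; first exact: of_coords_supported.
pose g := f - \sum_j (ev s B f (Z (p j)))%:P *: e j.
have sg : sect s B g.
  apply/supportedD/supportedN => //; apply: supported_sumr => j _.
  by apply/supportedZ/of_coords_supported.
suff g0 : g = 0 by apply/eqP; rewrite -subr_eq0 -/g g0.
apply: (coords_eq0 sg); apply: (can_inj (@trmxK _ _ _)).
apply: (can_inj (mulKmx uM)); rewrite trmx0 mulmx0; apply/colP => i.
rewrite -[LHS]evM' coordsK // hevalD hevalN heval_sum mxE.
rewrite (bigD1 i) //= hevalZ ee eqxx mulr1 big1 ?addr0 ?subrr // => j ji.
by rewrite hevalZ ee eq_sym (negPf ji) mulr0.
Qed.

End Unisolvent.

Section Curve.
Variables (k : closedFieldType) (r : nat).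
Notation sect := (@sect k r).
Notation ev s B f q := (@heval k r k idfun s B f q).

(** A vector space over an infinite field is not a finite union of proper subspaces: to [f] one adds
    [c g] with [c] off the finitely many ratios [- f(q) / g(q)]. *)
Lemma avoid_zeros s B (P : {poly {poly k}} -> Prop) (Q : seq ((k * k) * (k * k))) :
    P 0 -> (forall c f g, P f -> P g -> P (f + c%:P *: g)) ->
    (forall q, q \in Q -> exists2 f, P f & ev s B f q != 0) ->
  exists2 f, P f & forall q, q \in Q -> ev s B f q != 0.
Proof.
move=> P0 PD; elim: Q => [|q Q IHQ] hQ; first by exists 0.
have [|f Pf hf] := IHQ; first by move=> q' q'Q; apply: hQ; rewrite inE q'Q orbT.
have [g Pg hg] := hQ q (mem_head _ _).
have [c hc] := avoid_seq [seq - ev s B f q / ev s B g q | q <- q :: Q].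
exists (f + c%:P *: g) => [|q' q'Q]; first exact: PD.
rewrite hevalD hevalZ; case: (eqVneq (ev s B g q') 0) => [g0|g0].
  rewrite g0 mulr0 addr0; apply: hf; move: q'Q; rewrite inE.
  by case/predU1P => // e; rewrite -e g0 eqxx in hg.
apply: contraNneq hc => /eqP e; apply/mapP; exists q' => //.
by apply: (mulIf g0); rewrite divfK //; apply/eqP; rewrite -addr_eq0 addrC.
Qed.

Lemma ev_affine s B f t u : sect s B f -> ev s B f ((1, t), (u, 1)) = (fibre t f).[u].
Proof.
move: f; apply: supportedP => [|f g hf hg|c p pB pw].
- by rewrite heval0 rmorph0 horner0.
- by rewrite hevalD rmorphD hornerD hf hg.
rewrite hevalZ heval_bimono //= !expr1n mul1r mulr1 /bimono -!mul_polyC !rmorphM /=.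
rewrite !fibre_polyC /fibre map_polyXn !hornerM !hornerC !hornerXn.
by rewrite /idfun.
Qed.

Lemma ev_infty s B f t : sect s B f -> ev s B f ((1, t), (1, 0)) = (f`_B).[t].
Proof.
move: f; apply: supportedP => [|f g hf hg|c p pB pw].
- by rewrite heval0 coef0 horner0.
- by rewrite hevalD coefD hornerD hf hg.
rewrite hevalZ heval_bimono //= !expr1n !mul1r expr0n subn_eq0.
rewrite coefZ /bimono coefZ coefXn [B == _]eqn_leq [(p.2 <= B)%N]pB andbT.
by case: leqP => _; rewrite !hornerE ?hornerXn ?mulr1 ?mulr0.
Qed.

(* The restriction to the fibre x0 = 0. *)
Definition top_form s B f : {poly k} := heval r polyC s B f ((0, 1), ('X, 1)).

Lemma top_formE s B f : top_form s B f = \poly_(l < B.+1) f`_l`_(s + r * l).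
Proof.
rewrite poly_def; apply: eq_bigr => l _; rewrite big_ord_recr /= big1 ?add0r.
  by rewrite subnn expr0 !expr1n !mul1r !mulr1 mul_polyC.
move=> j _; rewrite expr0n subn_eq0 leqNgt ltn_ord /=; ring.
Qed.

Lemma ev_top_form s B f u : ev s B f ((0, 1), (u, 1)) = (top_form s B f).[u].
Proof.
rewrite -[RHS]/(horner_eval u _) rmorph_heval /=.
rewrite rmorph0 !rmorph1 {2}/horner_eval hornerX.
by apply: eq_heval => a; rewrite /= /horner_eval hornerC.
Qed.

(** Vanishing on the fibre [x0 = 0] means divisibility of the form by [x0]. Since [x0 = 1] in the
    affine chart, dividing leaves [f] unchanged and only lowers [s]. *)
Lemma sect_top_form0 s B f : sect s.+1 B f -> (top_form s.+1 B f == 0) -> sect s B f.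
Proof.
move=> sf; rewrite top_formE => /eqP/polyP t0 l j.
case: (ltnP l B.+1) => [lB|lB _]; last by apply: sf; rewrite ltnNge lB.
rewrite /= -leqNgt leq_eqVlt => /predU1P[e|lt].
  by have := t0 l; rewrite coef_poly lB coef0 addSn e.
by apply: sf; rewrite negb_and -!leqNgt addSn lt orbT.
Qed.

Lemma top_formS s B f : sect s B f -> top_form s.+1 B f = 0.
Proof.
move=> sf; rewrite top_formE; apply/polyP => l; rewrite coef_poly coef0.
by case: ifP => // _; apply: sf; rewrite negb_and -!leqNgt addSn leqnn orbT.
Qed.

Lemma sect_widen s s' B f : (s <= s')%N -> sect s B f -> sect s' B f.
Proof.
move=> ss sf l j h; apply: sf; apply: contra h => /andP[-> h]; apply: leq_trans h _.
by rewrite ltnS leq_add2r.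
Qed.

Lemma sect_large B (f : {poly {poly k}}) : (size f <= B.+1)%N -> exists s, sect s B f.
Proof.
move=> sf; exists (\sum_(l < B.+1) size (f`_l)%R)%N => l j.
case: (ltnP l B.+1) => [lB|lB _]; last by rewrite [f`_l]nth_default ?coef0 // (leq_trans sf).
rewrite /= -leqNgt (bigD1 (Ordinal lB)) //= => h.
by apply: nth_default; apply: leq_trans (ltnW h); rewrite -addnA leq_addr.
Qed.

(** Sizes bound the outer degree of [U]. Its inner degrees are bounded by some large [s], which is
    lowered one step at a time: [top_form] is multiplicative and nonzero on [C], so it vanishes on
    [U] as long as [s] exceeds [s']. *)
Lemma sect_quotient s B s' B' C U :
    sect s B C -> size C = B.+1 -> top_form s B C != 0 ->
  sect (s + s') (B + B') (C * U) -> sect s' B' U.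
Proof.
move=> sC zC tC sX.
case: (eqVneq U 0) => [->|U0]; first exact: supported0.
have C0 : C != 0 by rewrite -size_poly_gt0 zC.
have sU : (size U <= B'.+1)%N.
  by have := supported_size sX; rewrite size_mul // zC addSn /= -addnS leq_add2l.
have [s2 hs2] := sect_large sU.
have : sect (s' + s2) B' U by apply: sect_widen hs2; apply: leq_addl.
elim: s2 {hs2} => [|n IHn]; first by rewrite addn0.
rewrite addnS => hU; apply: IHn; apply: (sect_top_form0 hU).
have : top_form (s + (s' + n).+1) (B + B') (C * U) = 0.
  by rewrite addnS; apply/top_formS/(sect_widen _ sX); rewrite addnA leq_addr.
rewrite /top_form (hevalM _ _ sC hU) => /eqP.
by rewrite mulf_eq0 (negPf tC).
Qed.

Lemma closed_roots (f : {poly k}) : f != 0 -> exists rs : seq k, forall t, root f t = (t \in rs).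
Proof.
move=> f0; have [rs e] := closed_field_poly_normal f; exists rs => t.
by rewrite e rootZ ?lead_coef_eq0 // root_prod_XsubC.
Qed.

(** The conclusion is the absence of a common component in checkable form. A component not inside a
    fibre meets [t = t0], where G and C share no affine zero and C is nonzero at [u = oo]; the last
    clause excludes common fibres. The conditions on [size] and [top_form] say that C contains
    neither [u = oo] nor [x0 = 0]. *)
Lemma coprime_curve n (p : 'I_n -> hquad k) a d G :
    (forall q, hquad_valid q -> (forall i, ~ torus_equiv r (p i) q) ->
      exists f, [/\ sect a a f, forall i, ev a a f (p i) = 0 & ev a a f q != 0]) ->
    sect d d G -> G != 0 ->
  exists C t0, [/\ sect a a C, forall i, ev a a C (p i) = 0,
    size C = a.+1, top_form a a C != 0 &
    [/\ (lead_coef G).[t0] != 0, (lead_coef C).[t0] != 0,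
        coprimep (fibre t0 G) (fibre t0 C) &
        forall t, fibre t G != 0 \/ fibre t C != 0]].
Proof.
move=> bpf sG G0.
(* C is made nonzero at finitely many points off the p i: the zeros of G on a
   general fibre t = t0, one point of that fibre at u = oo, one point on each
   fibre t = t1 where G may vanish identically, and one point on x0 = 0. *)
pose us := [seq (p i).2.1 * (p i).1.1 ^+ r / (p i).2.2 | i <- enum 'I_n] ++
  [seq (p i).2.1 * (p i).1.2 ^+ r / (p i).2.2 | i <- enum 'I_n].
have [u1 hu1] := avoid_seq us.
have lG0 : lead_coef G != 0 by rewrite lead_coef_eq0.
have [rs hrs] := closed_roots lG0.
(* The fibre [t = t0] misses every [p i], and G keeps its full outer degree on it. *)
have [t0] := avoid_seq ([seq (p i).1.2 / (p i).1.1 | i <- enum 'I_n] ++ rs).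
rewrite mem_cat negb_or -hrs => /andP[ht0 rt0].
have lG : (lead_coef G).[t0] != 0 by [].
have G_t t : (lead_coef G).[t] != 0 -> fibre t G != 0.
  apply: contraNneq => /polyP /(_ (size G).-1); rewrite coef_fibre coef0.
  by rewrite lead_coefE => ->.
have [us0 hus0] := closed_roots (G_t _ lG).
have neq_t u v i : ~ torus_equiv r (p i) ((1, t0), (u, v)).
  case=> al [be [al0 be0 [e1 e2 _ _]]]; case/negP: ht0; apply/mapP; exists i.
    by rewrite mem_enum.
  have x0 : (p i).1.1 != 0 by apply: contra_eq_neq e1 => ->; rewrite mulr0 oner_neq0.
  by rewrite e2; apply: (mulIf x0); rewrite divfK // mulrAC -e1 mul1r.
have u_of (x al be w0 w1 : k) : 1 = al * x -> 1 = be * al ^+ r * w1 -> be * w0 = w0 * x ^+ r / w1.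
  move=> e1 e4; have w10 : w1 != 0 by apply: contra_eq_neq e4 => ->; rewrite mulr0 oner_neq0.
  have al0 : al ^+ r != 0.
    by apply: contra_eq_neq e4 => ->; rewrite mulr0 mul0r oner_neq0.
  apply: (mulIf w10); rewrite divfK //; apply: (mulIf al0).
  rewrite -[RHS]mulrA -exprMn [x * _]mulrC -e1 expr1n mulr1 -[RHS]mulr1 e4; ring.
have neq_u1 t i : ~ torus_equiv r (p i) ((1, t), (u1, 1)).
  case=> al [be [al0 be0 [e1 _ e3 e4]]]; case/negP: hu1; rewrite mem_cat.
  apply/orP; left; apply/mapP; exists i; first by rewrite mem_enum.
  by rewrite e3; apply: u_of e4.
have neq_u1' i : ~ torus_equiv r (p i) ((0, 1), (u1, 1)).
  case=> al [be [al0 be0 [_ e1 e3 e4]]]; case/negP: hu1; rewrite mem_cat.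
  apply/orP; right; apply/mapP; exists i; first by rewrite mem_enum.
  by rewrite e3; apply: u_of e4.
pose Q : seq ((k * k) * (k * k)) :=
  [:: ((1, t0), (1, 0)), ((0, 1), (u1, 1)) &
    [seq ((1, t0), (u, 1)) | u <- us0] ++ [seq ((1, t), (u1, 1)) | t <- rs]].
pose P f := sect a a f /\ forall i, ev a a f (p i) = 0.
have [| |q qQ|C [sC C0] hC] := @avoid_zeros a a P Q.
- by split=> [|i]; [exact: supported0 | rewrite heval0].
- move=> c f g [sf f0] [sg g0]; split=> [|i]; first by apply/supportedD/supportedZ.
  by rewrite hevalD hevalZ f0 g0 mulr0 addr0.
- have [] := bpf q.
  + move: qQ; rewrite !inE mem_cat => /or3P[/eqP ->|/eqP ->|/orP[] /mapP[x _ ->]];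
    by rewrite /hquad_valid /= !xpair_eqE ?oner_eq0 ?andbF.
  + move=> i; move: qQ; rewrite !inE mem_cat.
    by move=> /or3P[/eqP ->|/eqP ->|/orP[] /mapP[x _ ->]].
  by move=> f [sf f0 fq]; exists f.
have Ca : (C`_a).[t0] != 0.
  by rewrite -(ev_infty _ sC); apply: hC; rewrite inE eqxx.
have zC : size C = a.+1.
  apply/eqP; rewrite eqn_leq (supported_size sC) /= ltnNge.
  by apply: contra Ca => /leq_sizeP ->; rewrite ?horner0.
exists C, t0; split=> //.
  have : ev a a C ((0, 1), (u1, 1)) != 0 by apply: hC; rewrite !inE eqxx orbT.
  by rewrite ev_top_form; apply: contraNneq => ->; rewrite horner0.
split=> //; first by rewrite lead_coefE zC.
  apply: Pdiv.ClosedField.root_coprimep => u ru; rewrite -(ev_affine _ _ sC); apply: hC.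
  by rewrite !inE mem_cat (map_f (fun u => ((1, t0), (u, 1)))) ?orbT // -hus0.
move=> t; case: (boolP (root (lead_coef G) t)) => [|h]; last by left; apply: G_t.
rewrite hrs => tr; right.
have : ev a a C ((1, t), (u1, 1)) != 0.
  by apply: hC; rewrite !inE mem_cat (map_f (fun t => ((1, t), (u1, 1)))) // !orbT.
by rewrite (ev_affine _ _ sC); apply: contraNneq => ->; rewrite horner0.
Qed.

End Curve.

(** * The intersection inequality *)

(** With [h] the Hilbert function, h(q+a+d) + h(q) - h(q+a) - h(q+d) = (r+2) a d, as constant and
    linear terms cancel. *)
Lemma count_arith (r q a d h1 h2 h3 h4 u v : nat) :
  (2 * h1 = (r + 2) * q ^ 2 + (r + 4) * q + 2)%N ->
  (2 * h2 = (r + 2) * (q + a) ^ 2 + (r + 4) * (q + a) + 2)%N ->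
  (2 * h3 = (r + 2) * (q + d) ^ 2 + (r + 4) * (q + d) + 2)%N ->
  (2 * h4 = (r + 2) * (q + a + d) ^ 2 + (r + 4) * (q + a + d) + 2)%N ->
  (h2 + h3 + (u + v) <= h4 + h1 + v)%N -> (u <= (r + 2) * a * d)%N.
Proof.
rewrite -!mulnn => e1 e2 e3 e4 h.
have e : (2 * h4 + 2 * h1 = 2 * h2 + 2 * h3 + 2 * ((r + 2) * a * d))%N.
  rewrite e1 e2 e3 e4; ring.
lia.
Qed.

Lemma matrix_rows_linear (R : nzRingType) m n (b : R) (u v : 'I_m -> 'rV[R]_n) :
  \matrix_i (b *: u i + v i) = b *: \matrix_i u i + \matrix_i v i.
Proof. by apply/matrixP => i j; rewrite !mxE. Qed.

(** * The Hilbert function of L, and sections with a prescribed jet *)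

Section LocalSections.
Variables (k : fieldType) (r : nat).
Notation sect := (@sect k r).

(** Riemann-Roch for sL, doubled: L^2 = r + 2 and -K.L = r + 4. *)
Lemma size_sections s : (2 * nsections r s s = (r + 2) * s ^ 2 + (r + 4) * s + 2)%N.
Proof.
rewrite /nsections size_staircase.
have H n : (2 * \sum_(l < n) (s + r * l).+1 + r * n = 2 * (s + 1) * n + r * n ^ 2)%N.
  elim: n => [|n IHn]; first by rewrite big_ord0 !muln0.
  rewrite big_ord_recr /= -[in X in _ = X]addn1; move: IHn.
  move: (\sum_(_ < _) _)%N => S; rewrite -!mulnn; nia.
have := H s.+1; move: (\sum_(_ < _) _)%N => S; rewrite -!mulnn; nia.
Qed.

Lemma taylorD c z s B f g :
  taylor r c z s B (f + g) = taylor r c z s B f + taylor r c z s B g :> {poly {poly k}}.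
Proof. exact: hevalD. Qed.

Lemma taylorZ c z s B a f :
  taylor r c z s B (a%:P *: f) = a%:P *: taylor r c z s B f :> {poly {poly k}}.
Proof. by rewrite /taylor hevalZ /= mul_polyC. Qed.

(** In the chart this is a monomial in the coordinates centred at [z]; the power of the chart unit,
    equal to 1 there, pads all of them to a common degree. *)
Definition local_monomial c (z : k * k) x y w : {poly {poly k}} :=
  (chart_x k r c - z.1%:P *: chart_unit k r c) ^+ x * (chart_y k r c - z.2%:P *: chart_unit k r c) ^+ y
    * chart_unit k r c ^+ w.

Lemma sect_local_monomial c z x y w :
  sect (x + y + w) (x + y + w) (local_monomial c z x y w).
Proof.
have se (f : {poly {poly k}}) b n : sect 1 1 f -> sect n n ((f - b%:P *: chart_unit k r c) ^+ n).
  move=> sf; rewrite -[n in sect n n]mul1n; apply: sectX; apply: supportedD => //.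
  exact/supportedN/supportedZ/sect_chart_unit.
apply: sectM; first by apply: sectM; apply: se; [apply: sect_chart_x | apply: sect_chart_y].
by rewrite -[w in sect w w]mul1n; apply/sectX/sect_chart_unit.
Qed.

Lemma heval_local_monomial (A : comNzRingType) (K : {rmorphism k -> A}) c z x y w X Y :
  heval r K (x + y + w) (x + y + w) (local_monomial c z x y w) (chart_quad c X Y) =
  (X - K z.1) ^+ x * (Y - K z.2) ^+ y.
Proof.
have ss := @sect_chart_unit k r c.
have sx : sect 1 1 (chart_x k r c - z.1%:P *: chart_unit k r c).
  by apply: supportedD; [apply: sect_chart_x | apply/supportedN/supportedZ].
have sy : sect 1 1 (chart_y k r c - z.2%:P *: chart_unit k r c).
  by apply: supportedD; [apply: sect_chart_y | apply/supportedN/supportedZ].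
have X1 := sectX (n := x) sx; have Y1 := sectX (n := y) sy; have W1 := sectX (n := w) ss.
rewrite -[x in (x + _ + _)%N]mul1n -[y in (_ + y + _)%N]mul1n -[w in (_ + _ + w)%N]mul1n.
rewrite !hevalM ?hevalX //; try exact: sectM.
by rewrite !hevalD !hevalN !hevalZ heval_chart_x heval_chart_y heval_chart_unit_quad !mulr1 expr1n mulr1.
Qed.

(** Sections of (m-1)L realise every jet modulo order [m]; their Taylor expansion is exactly the
    polynomial with coordinates [v], with no higher terms. *)
Definition local_sect c (z : k * k) m (v : 'rV[k]_(size (staircase m (fun l => m - l)%N))) :
    {poly {poly k}} :=
  \sum_t (v 0 t)%:P *: (let p := nth (0, 0)%N (staircase m (fun l => m - l)%N) t in
    local_monomial c z p.1 p.2 (m.-1 - (p.1 + p.2))).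

Section Local.
Variables (c : chart) (z : k * k) (m : nat).
Notation local_sect := (@local_sect c z m).

Let le_stair (t : 'I_(size (staircase m (fun l => m - l)%N))) :
  let p := nth (0, 0)%N (staircase m (fun l => m - l)%N) t in (p.1 + p.2 <= m.-1)%N.
Proof. by have := mem_nth (0, 0)%N (ltn_ord t); rewrite mem_staircase /=; lia. Qed.

Lemma sect_local v : sect m.-1 m.-1 (local_sect v).
Proof.
apply: supported_sumr => t _; apply: supportedZ => /=.
have /= := le_stair t; case: (nth _ _ _) => x y /= xy.
by have := @sect_local_monomial c z x y (m.-1 - (x + y)); rewrite subnKC.
Qed.

Lemma taylor_local v : taylor r c z m.-1 m.-1 (local_sect v) = of_coords v.
Proof.
rewrite /taylor heval_sum; apply: eq_bigr => t _; rewrite hevalZ /= mul_polyC.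
congr (_ *: _); have /= := le_stair t; case: (nth _ _ _) => x y /= xy.
rewrite -[in LHS](subnKC xy) addKn heval_local_monomial.
by rewrite ![coef2 _ + _]addrC !addrK /bimono -mul_polyC rmorphXn.
Qed.

End Local.

Lemma local_sectP c z m a u v :
  @local_sect c z m (a *: u + v) = a%:P *: local_sect c z u + local_sect c z v.
Proof.
rewrite /local_sect scaler_sumr -big_split /=; apply: eq_bigr => t _.
by rewrite scalerA -scalerDl !mxE -polyCM -polyCD.
Qed.

End LocalSections.

(** * The dimension count *)

Section Count.
Variables (k : closedFieldType) (r : nat).
Notation sect := (@sect k r).
Notation ev s B f q := (@heval k r k idfun s B f q).
Let sec_space s := 'rV[k]_(nsections r s s).
Let jet_size m := size (staircase m (fun l => m - l)%N).

Lemma jet_sizeS m : jet_size m.+1 = (m.+1 + jet_size m)%N.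
Proof.
by rewrite /jet_size !size_staircase big_ord_recl subn0.
Qed.

Lemma intersection_bound n (p : 'I_n -> hquad k) a d m G C t0 :
    (forall i, hquad_valid (p i)) ->
    (forall i j, i != j -> ~ torus_equiv r (p i) (p j)) ->
    sect d d G ->
    (forall i, exists2 c, in_chart c (p i) &
      ord_ge m (taylor r c (chart_coord r c (p i)) d d G)) ->
    sect a a C -> (forall i, ev a a C (p i) = 0) ->
    size C = a.+1 -> top_form r a a C != 0 ->
    (lead_coef G).[t0] != 0 -> (lead_coef C).[t0] != 0 ->
    coprimep (fibre t0 G) (fibre t0 C) ->
    (forall t, fibre t G != 0 \/ fibre t C != 0) ->
  (n * m <= (r + 2) * a * d)%N.
Proof.
case: m => [|m]; first by rewrite muln0.
case: n p => [|n] p; first by [].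
move=> vp np sG oG sC vC zC tC lG lC cop GC.
have [c hc {}oG] := fin_all_exists2 oG.
pose z i := chart_coord r (c i) (p i).
have ex_l i j : exists l, sect 1 1 l /\ (ev 1 1 l (p i) != 0 /\
    (i != j -> ev 1 1 l (p j) = 0)).
  case: (eqVneq i j) => [_|ij].
    by exists (chart_unit k r (c i)); rewrite heval_chart_unit_neq0; do !split=> //; exact: sect_chart_unit.
  have [|l [sl l0 l1]] := @separation k r (p j) (p i) (vp i).
    by apply: np; rewrite eq_sym.
  by exists l.
have [l hl] := fin_all_exists (fun i => fin_all_exists (ex_l i)).
(* [H i] is nonzero at [p i] and has order at least [M] at the other points. [M] exceeds [m] so that
   these points do not interfere, and [a + d] so that the subtraction defining [q] is exact. *)
pose M := (m + a + d).+1; pose H i := \prod_j (l i j ^+ M).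
have sl i j : sect M M (l i j ^+ M).
  by have [sl _] := hl i j; have := sectX (n := M) sl; rewrite mul1n.
have sH i : sect (M * n.+1) (M * n.+1) (H i) by apply: sect_prod.
have T0 i s B f : ((taylor r (c i) (z i) s B f)`_0`_0 == 0) = (ev s B f (p i) == 0).
  by rewrite taylor_coef0 (heval_chart_eq0 _ _ _ _ (hc i)).
have TH i j : taylor r (c i) (z i) (M * n.+1) (M * n.+1) (H j) =
    \prod_j' taylor r (c i) (z i) 1 1 (l j j') ^+ M.
  rewrite /taylor heval_prod //; apply: eq_bigr => j' _; have [slj _] := hl j j'.
  by rewrite -(hevalX _ M _ slj) mul1n.
have oH i j : i != j -> ord_ge m.+1 (taylor r (c i) (z i) (M * n.+1) (M * n.+1) (H j)).
  move=> ij; rewrite TH (bigD1 i) //= mulrC; apply: ord_geMl.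
  have [_ [_ lv]] := hl j i.
  have le_mM : (m.+1 <= M)%N by rewrite /M; lia.
  have /ord_ge_exp h : ord_ge 1 (taylor r (c i) (z i) 1 1 (l j i)).
    by apply/ord_ge1/eqP; rewrite T0 lv // eq_sym.
  by move=> x y xy; apply: (h M); apply: leq_trans xy le_mM.
have uH i : (taylor r (c i) (z i) (M * n.+1) (M * n.+1) (H i))`_0`_0 != 0.
  rewrite -!horner_coef0 TH !horner_prod prodf_seq_neq0; apply/allP => j _ /=.
  rewrite !horner_exp expf_neq0 // !horner_coef0 T0.
  by case: (hl i j) => _ [].
pose q := (M * n.+1 + m - a - d)%N.
have eN : (M * n.+1 + m = q + a + d)%N by rewrite /q /M; lia.
pose E i w := local_sect r (c i) (z i) (m := m.+1) w.
(* (x, y, w) |-> x G + y C + sum_i H_i E_i(w_i), together with the (m - 1)-jets of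
   y at the points and a left inverse of U |-> C U applied to x, is injective. *)
pose Phi (x : sec_space (q + a)) (y : sec_space (q + d)) (w : 'M[k]_(n.+1, jet_size m.+1)) :=
  of_coords x * G + of_coords y * C + \sum_i H i * E i (row i w).
have sHE i w : sect (q + a + d) (q + a + d) (H i * E i w).
  by rewrite -eN; apply: sectM (sH i) (@sect_local k r (c i) (z i) m.+1 w).
have sxG (x : sec_space (q + a)) : sect (q + a + d) (q + a + d) (of_coords x * G).
  by apply: sectM => //; apply: of_coords_supported.
have syC (y : sec_space (q + d)) : sect (q + a + d) (q + a + d) (of_coords y * C).
  by rewrite addnAC; apply: sectM => //; apply: of_coords_supported.
have sPhi x y w : sect (q + a + d) (q + a + d) (Phi x y w).
  apply: supportedD; last by apply: supported_sumr => i _; apply: sHE.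
  by apply: supportedD; [apply: sxG | apply: syC].
have C0 : C != 0 by rewrite -size_poly_gt0 zC.
have [la [lal laK]] : exists la : sec_space (q + a) -> sec_space q,
    (forall b u v, la (b *: u + v) = b *: la u + la v) /\
    forall u, la (coords _ _ (C * of_coords u)) = u.
  apply: (injective_dim (f := fun u : sec_space q =>
    coords _ _ (C * of_coords u) : sec_space (q + a)) _ _).2 => [b u v|u u0].
    by rewrite of_coords_linear mulrDr -scalerAr coords_linear.
  have : C * of_coords u = 0.
    apply: coords_eq0 u0; rewrite -/(sect _ _ _) [(q + a)%N]addnC.
    by apply: sectM => //; apply: of_coords_supported.
  move/eqP; rewrite mulf_eq0 (negPf C0) => /eqP u00.
  by rewrite -[u]of_coordsK u00; apply/rowP => j; rewrite !mxE !coef0.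
pose jet y i : 'rV[k]_(jet_size m) :=
  coords _ _ (taylor r (c i) (z i) (q + d) (q + d) (of_coords (y : sec_space (q + d)))).
pose F (u : sec_space (q + a) * sec_space (q + d) * 'M[k]_(n.+1, jet_size m.+1)) :
    sec_space (q + a + d) * sec_space q * 'M[k]_(n.+1, jet_size m) :=
  (coords _ _ (Phi u.1.1 u.1.2 u.2), la u.1.1, \matrix_i jet u.1.2 i).
have [|[[x y] w] []|] := @injective_dim k _ _ F.
- move=> b [[x y] w] [[x' y'] w']; rewrite /F /=.
  have PhiP : Phi (b *: x + x') (b *: y + y') (b *: w + w') =
      b%:P *: Phi x y w + Phi x' y' w'.
    rewrite /Phi !of_coords_linear !mulrDl -!scalerAl.
    under eq_bigr => i _ do rewrite linearP /E local_sectP mulrDr -scalerAr.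
    rewrite big_split /= -scaler_sumr !scalerDr -!addrA; congr (_ + _).
    by rewrite addrCA; congr (_ + _); rewrite [RHS]addrCA; congr (_ + _); rewrite addrCA.
  congr (_, _, _); [by rewrite PhiP coords_linear | exact: lal |].
  have jetP i : jet (b *: y + y') i = b *: jet y i + jet y' i.
    by rewrite /jet of_coords_linear taylorD taylorZ coords_linear.
  by rewrite -matrix_rows_linear; apply/row_matrixP => i; rewrite !rowK jetP.
- rewrite /F /= => Phi0 la0 jet0.
  have {}Phi0 := coords_eq0 (sPhi x y w) Phi0.
  have oy i : ord_ge m (taylor r (c i) (z i) (q + d) (q + d) (of_coords y)).
    apply: ord_ge_coords; move/row_matrixP: jet0 => /(_ i).
    by rewrite rowK row0.
  (* At [p i] every other term has order [m.+1]: G by hypothesis, [y C] because [y] has order [m]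
     and C vanishes there, and [H j] for [j != i]. Dividing by the unit [H i] leaves a jet of degree
     at most [m], hence zero. *)
  have w0 : w = 0.
    apply/row_matrixP => i; rewrite row0.
    have : ord_ge m.+1 (taylor r (c i) (z i) (q + a + d) (q + a + d) (H i * E i (row i w))).
      have -> : H i * E i (row i w) = - (of_coords x * G + of_coords y * C +
          \sum_(j | j != i) H j * E j (row j w)).
        move: Phi0; rewrite /Phi (bigD1 i) //= => e.
        by apply/eqP; rewrite -addr_eq0 addrCA e.
      rewrite /taylor hevalN; apply: ord_geN; rewrite !hevalD heval_sum.
      apply: ord_geD; first apply: ord_geD.
      + rewrite hevalM //; last exact: of_coords_supported.
        by apply: ord_geMl; apply: oG.
      + rewrite addnAC hevalM //; last exact: of_coords_supported.
        rewrite -addn1; apply: ord_geM; first exact: oy.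
        by apply/ord_ge1/eqP; rewrite T0 vC.
      apply: ord_ge_sum => j ji; rewrite -eN hevalM //; last exact: (@sect_local k r (c _) (z _) m.+1).
      by rewrite mulrC; apply: ord_geMl; apply: oH; rewrite eq_sym.
    rewrite -eN /taylor hevalM //; last exact: (@sect_local k r (c _) (z _) m.+1).
    move/(ord_ge_unit (uH i)).
    rewrite -/(taylor r (c i) (z i) m.+1.-1 m.+1.-1 (local_sect r (c i) (z i) (row i w))).
    rewrite taylor_local => o.
    have := ord_ge_supported (of_coords_supported _) o => e.
    by rewrite -[row i w]of_coordsK e; apply/rowP => j; rewrite !mxE !coef0.
  move: Phi0; rewrite /Phi w0 big1 ?addr0 => [|i _]; last first.
    have -> : E i (row i 0) = 0; last by rewrite mulr0.
    by rewrite /E /local_sect big1 // => t _; rewrite !mxE scale0r.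
  (* What remains is [x G + y C = 0], so [x = C U]; the component [la x] of [F] is then [U] itself,
     which must vanish. *)
  move/(syzygy lG lC cop GC) => [U [eX eY]].
  have sU : sect q q U.
    apply: (sect_quotient sC zC tC); rewrite -eX addnC; exact: of_coords_supported.
  have U0 : coords _ _ U = 0 :> sec_space q.
    rewrite -[LHS]laK coordsK // -eX of_coordsK; exact: la0.
  have {}U0 := coords_eq0 sU U0.
  have x0 : x = 0.
    by rewrite -[x]of_coordsK eX U0 mulr0; apply/rowP => j; rewrite !mxE !coef0.
  have y0 : y = 0.
    by rewrite -[y]of_coordsK eY U0 mulr0 oppr0; apply/rowP => j; rewrite !mxE !coef0.
  by rewrite x0 y0.
rewrite !dimvf => le_dim _.
have {le_dim} : (1 * nsections r (q + a) (q + a) + 1 * nsections r (q + d) (q + d) +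
    n.+1 * jet_size m.+1 <= 1 * nsections r (q + a + d) (q + a + d) + 1 * nsections r q q +
    n.+1 * jet_size m)%N by exact: le_dim.
(* Source and target contain jets modulo orders [m.+1] and [m]; the difference, [m.+1] per point, is
   the contribution of the multiplicity. *)
rewrite jet_sizeS mulnDr !mul1n.
exact: (count_arith (size_sections r q) (size_sections r _) (size_sections r _) (size_sections r _)).
Qed.

End Count.

Section Bound.
Variables (k : closedFieldType) (r : nat).
Notation sect := (@sect k r).
Notation ev s B f q := (@heval k r k idfun s B f q).

Lemma vanishing_bound n (Z : 'I_n -> hquad k) e d m G :
    (forall i, hquad_valid (Z i)) ->
    (forall f, sect e e f -> (forall i, ev e e f (Z i) = 0) -> f = 0) ->
    sect d d G -> G != 0 ->
    (forall i, exists2 c, in_chart c (Z i) &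
      ord_ge m (taylor r c (chart_coord r c (Z i)) d d G)) ->
  (e.+1 * m <= (r + 2) * d)%N.
Proof.
move=> vZ inj sG G0 oG.
have [p [s [ss sE sB]]] := unisolvent inj.
have np i j : i != j -> ~ torus_equiv r (Z (p i)) (Z (p j)).
  move=> ij [a [b [a0 b0 e_ij]]].
  have := sE j i; rewrite e_ij heval_torus sE eqxx mulr1 eq_sym (negPf ij) => /eqP.
  by rewrite mulf_eq0 !expf_eq0 (negPf a0) (negPf b0) !andbF.
have bpf q : hquad_valid q -> (forall i, ~ torus_equiv r (Z (p i)) q) ->
    exists f, [/\ sect e.+1 e.+1 f, forall i, ev e.+1 e.+1 f (Z (p i)) = 0 &
                  ev e.+1 e.+1 f q != 0].
  move=> vq nq; have [c hc] := valid_in_chart vq.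
  have sc : sect e e (chart_unit k r c ^+ e).
    by have := sectX (n := e) (@sect_chart_unit k r c); rewrite mul1n.
  (* The [s j] span the sections of eL, among them the power of a chart unit that is nonzero at
     [q]. *)
  have [j sj] : exists j, ev e e (s j) q != 0.
    case: (boolP [forall j, ev e e (s j) q == 0]) => [/forallP s0|]; last first.
      by rewrite negb_forall => /existsP.
    have : ev e e (chart_unit k r c ^+ e) q != 0.
      have := hevalX idfun e q (@sect_chart_unit k r c); rewrite mul1n => ->.
      by rewrite expf_neq0 // heval_chart_unit_neq0.
    rewrite (sB _ sc) heval_sum big1 ?eqxx // => j _.
    by rewrite hevalZ (eqP (s0 j)) mulr0.
  have [l [sl l0 lq]] := separation vq (nq j).
  (* The s j generate: some s j is nonzero at q, and l moves its extra zero to p j. *)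
  exists (l * s j); rewrite -[e.+1]add1n; split.
  - exact: sectM.
  - move=> i; rewrite hevalM // sE; case: eqP => [->|_]; first by rewrite l0 mul0r.
    by rewrite mulr0.
  - by rewrite hevalM // mulf_neq0.
have [C [t0 [sC vC zC tC [lG lC cop GC]]]] := coprime_curve bpf sG G0.
have := intersection_bound (fun i => vZ (p i)) np sG (fun i => oG (p i)) sC vC zC tC lG lC cop GC.
(* The difference is r e (e + 1) / 2. One factor [e.+1] then cancels against the degree of C. *)
have : (e.+1 * e.+1 <= nsections r e e)%N.
  by have := size_sections r e; rewrite -mulnn; nia.
move: (nsections r e e) => h le1 le2.
have : (e.+1 * (e.+1 * m) <= e.+1 * ((r + 2) * d))%N.
  by apply: leq_trans (leq_trans _ le2) _; [rewrite mulnA leq_mul2r le1 orbT | lia].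
by rewrite leq_mul2l.
Qed.

End Bound.

(** * The ideal sheaf in the function field *)

Lemma rmorph_mmap n (R S T : comNzRingType) (h : {rmorphism S -> T}) (f : R -> S)
    (v : 'I_n -> S) (p : {mpoly R[n]}) :
  h (mmap f v p) = mmap (h \o f) (h \o v) p.
Proof.
rewrite /mmap rmorph_sum; apply: eq_bigr => m _; rewrite rmorphM; congr (_ * _).
by rewrite /mmap1 rmorph_prod; apply: eq_bigr => i _; rewrite rmorphXn.
Qed.

Lemma eq_mmap n (R S : comNzRingType) (f f' : R -> S) (v v' : 'I_n -> S) (p : {mpoly R[n]}) :
  f =1 f' -> v =1 v' -> mmap f v p = mmap f' v' p.
Proof.
move=> ff vv; apply: eq_bigr => m _; rewrite ff; congr (_ * _).
by apply: eq_bigr => i _; rewrite vv.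
Qed.

Lemma in_chart_affine (F : fieldType) (t u : F) c :
  t != 0 -> u != 0 -> in_chart c ((1, t), (u, 1)).
Proof.
move=> t0 u0; case: c => [[] []];
  by rewrite /in_chart /base_den /fibre_den /= ?t0 ?u0 ?oner_neq0.
Qed.

(** The divisor e((r+1)F + E) is cut out by the form [x0 ^+ (e * r.+1) * w0 ^+ e], which takes the
    value [u ^+ e] at this point; its local equation is this value divided by the torus weight.
    Hence a form [f] of degree [e] corresponds to the rational function [f / u ^+ e]. *)
Lemma divisor_torus (F : fieldType) (t u : F) r e c :
    t != 0 -> u != 0 ->
    let q := ((1, t), (u, 1)) : hquad F in let z := chart_coord r c q in
  (if c.1 then z.1 ^+ (e * r.+1) else 1) * (if c.2 then 1 else z.2 ^+ e) *
  (base_den c q ^+ (e + r * e) *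
   (if c.2 then fibre_den c q else fibre_den c q / base_den c q ^+ r) ^+ e) = u ^+ e.
Proof.
move=> t0 u0 /=; have tr0 := expf_neq0 r t0.
have -> : (e + r * e = r.+1 * e)%N by rewrite mulSn.
rewrite /chart_coord /base_den /base_num /fibre_den mulnC.
have H (a b c' d : F) : a ^+ r.+1 * b * (c' ^+ r.+1 * d) = u ->
    a ^+ (r.+1 * e) * b ^+ e * (c' ^+ (r.+1 * e) * d ^+ e) = u ^+ e.
  by move=> <-; rewrite !exprM -!exprMn.
case: c => [[] []] /=.
- rewrite -[X in _ * X * (_ * _)](expr1n _ e); apply: H.
  by rewrite !exprS exprMn exprVn expr1n; move: (t ^+ r) tr0 => tr tr0; field; rewrite ?t0 ?tr0 ?oner_neq0.
- apply: H.
  by rewrite !exprS exprMn exprVn expr1n; move: (t ^+ r) tr0 => tr tr0; field; rewrite ?t0 ?tr0 ?oner_neq0.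
- by rewrite !(expr1n, mul1r).
by rewrite !(expr1n, mulr1, mul1r, invr1).
Qed.

(** Here [D1 = (u / S)^d] and [D2 = (u / S)^e]. With [S] the generic value of a chart unit, it
    compares a rational section of dL with a form [h] of larger degree [e] having the same chart
    polynomial. *)
Lemma twist_solve (F : fieldType) (d e : nat) (S u g h D1 D2 : F) :
    (d <= e)%N -> S != 0 -> u != 0 ->
    D1 * (S ^+ d / u ^+ d) = 1 -> D2 * (S ^+ e / u ^+ e) = 1 ->
  D1 * g = D2 * (h / u ^+ e) -> h = S ^+ (e - d) * (u ^+ d * g).
Proof.
move=> de S0 u0 e1 e2 e3.
have Sd := expf_neq0 d S0; have Se := expf_neq0 e S0.
have ud := expf_neq0 d u0; have ue := expf_neq0 e u0.
have eD1 : D1 = u ^+ d / S ^+ d.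
  by apply: (mulIf (mulf_neq0 Sd (invr_neq0 ud))); rewrite e1 mulrA divfK // divff.
have eD2 : D2 = u ^+ e / S ^+ e.
  by apply: (mulIf (mulf_neq0 Se (invr_neq0 ue))); rewrite e2 mulrA divfK // divff.
move: e3; rewrite eD1 eD2 expfB_cond ?(negPf S0) // => e3.
move: (S ^+ d) (S ^+ e) (u ^+ d) (u ^+ e) Sd Se ud ue e3 => a b c c' a0 b0 c0 c'0 e3.
have -> : b / a * (c * g) = b * (c / a * g) by field.
by rewrite e3; field; rewrite b0 c'0.
Qed.

Section Bridge.
Variables (k : fieldType) (r : nat).
Notation sect := (@sect k r).
Notation K := (@const_fun k).
Notation gen := (generic_pt k).
Notation X0 := ('X_(ord0 : 'I_2) : {mpoly k[2]}).
Notation X1 := ('X_(ord_max : 'I_2) : {mpoly k[2]}).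
Notation mC := (@mpolyC 2 k).
Notation t := (tofrac X0).
Notation u := (tofrac X1).

Definition subst2 (S : comNzRingType) (f : {rmorphism k -> S}) (a b : S) :
  {mpoly k[2]} -> S := mmap f (xy (a, b)).
HB.instance Definition _ S f a b := GRing.RMorphism.copy (@subst2 S f a b) (mmap f (xy (a, b))).

Lemma subst2C (S : comNzRingType) (f : {rmorphism k -> S}) a b c :
  subst2 f a b c%:MP = f c.
Proof. exact: mmapC. Qed.
Lemma subst2X0 (S : comNzRingType) (f : {rmorphism k -> S}) a b : subst2 f a b X0 = a.
Proof. by rewrite /subst2 mmapX mmap1U /xy eqxx. Qed.
Lemma subst2X1 (S : comNzRingType) (f : {rmorphism k -> S}) a b : subst2 f a b X1 = b.
Proof. by rewrite /subst2 mmapX mmap1U /xy. Qed.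

Lemma subst2_heval (S : comNzRingType) (h : {rmorphism k -> S}) a b s B f c :
  subst2 h a b (heval r mC s B f (chart_quad c X0 X1)) =
  heval r h s B f (chart_quad c a b).
Proof.
rewrite rmorph_heval (eq_heval _ _ _ _ _ (K' := h)) => [|x]; last exact: subst2C.
by congr (heval _ _ _ _ _ _); case: c => [[] []];
  rewrite /chart_quad /= subst2X0 subst2X1 rmorph1.
Qed.

Lemma heval_id s B f : sect s B f ->
  heval r (@coef2 k) s B f ((1, 'X%:P), ('X, 1)) = f.
Proof.
move: f; apply: supportedP => [|f g hf hg|c p pB pw].
- exact: heval0.
- by rewrite hevalD hf hg.
rewrite hevalZ heval_bimono //= !expr1n mul1r mulr1 -mul_polyC; congr (_ * _).
by rewrite /bimono -mul_polyC rmorphXn.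
Qed.

Lemma heval_generic s B f :
  heval r K s B f gen = tofrac (heval r mC s B f (chart_quad (false, false) X0 X1)).
Proof. by rewrite rmorph_heval /= rmorph1. Qed.

Lemma heval_generic_inj s B f : sect s B f -> heval r K s B f gen = 0 -> f = 0.
Proof.
move=> sf /eqP; rewrite heval_generic tofrac_eq0 => /eqP f0.
rewrite -(heval_id sf) -[heval _ _ _ _ _ _]/(heval r (@coef2 k) s B f
  (chart_quad (false, false) 'X%:P 'X)) -subst2_heval f0 rmorph0 //.
Qed.

Lemma heval_generic_widen s B s' B' f : (s <= s')%N -> (B <= B')%N -> sect s B f ->
  heval r K s' B' f gen = heval r K s B f gen.
Proof.
move=> ss BB; move: f; apply: supportedP => [|f g hf hg|c p pB pw].
- by rewrite !heval0.
- by rewrite !hevalD hf hg.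
by rewrite !hevalZ !heval_bimono //= ?expr1n //; lia.
Qed.

Lemma mpolyXi_neq0 (i : 'I_2) : 'X_i != 0 :> {mpoly k[2]}.
Proof.
by apply/eqP => /(congr1 (mcoeff U_(i))) /eqP; rewrite mcoeffXU eqxx mcoeff0 oner_eq0.
Qed.

Lemma t_neq0 : t != 0. Proof. by rewrite tofrac_eq0 mpolyXi_neq0. Qed.
Lemma u_neq0 : u != 0. Proof. by rewrite tofrac_eq0 mpolyXi_neq0. Qed.

Lemma generic_in_chart c : in_chart c gen.
Proof. exact: in_chart_affine t_neq0 u_neq0. Qed.

Notation z c := (chart_coord r c gen).

Lemma divisor_heval c e f :
  divisor_eq k r (e * r.+1) e c * (heval r K e e f gen / u ^+ e) =
  heval r K e e f (chart_quad c (z c).1 (z c).2).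
Proof.
rewrite {1}(torus_chart_quad r (generic_in_chart c)) heval_torus.
have u0 : u ^+ e != 0 by rewrite expf_neq0 // u_neq0.
have := divisor_torus r e c t_neq0 u_neq0; rewrite /= -/gen => E.
rewrite mulrA; apply: (mulIf u0); rewrite divfK // mulrA [RHS]mulrC; congr (_ * _).
exact: E.
Qed.
Notation chart_poly e c f := (heval r mC e e f (chart_quad c X0 X1)).

Lemma chart_fun_heval e c f :
  chart_fun r c (chart_poly e c f) =
  divisor_eq k r (e * r.+1) e c * (heval r K e e f gen / u ^+ e).
Proof.
rewrite divisor_heval -(subst2_heval K); exact: eq_mmap.
Qed.

Lemma hcoord_valid (p : hirzebruch k r) : hquad_valid (hcoord p).
Proof. by rewrite /hcoord; apply: valP. Qed.

Lemma meval_chart_poly e c f (w : k * k) :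
  (chart_poly e c f).@[xy w] = heval r idfun e e f (chart_quad c w.1 w.2).
Proof.
rewrite -(subst2_heval idfun); exact: eq_mmap.
Qed.

Lemma has_section_of_sect (Z : {fset hirzebruch k r}) e f : sect e e f -> f != 0 ->
    (forall p, p \in Z -> heval r idfun e e f (hcoord p) = 0) ->
  has_section Z 1 e.
Proof.
move=> sf f0 vf; exists (heval r K e e f gen / u ^+ e); split.
  apply: mulf_neq0; last by apply/invr_neq0/expf_neq0/u_neq0.
  by apply: contraNneq f0 => /(heval_generic_inj sf) ->.
move=> c; exists (chart_poly e c f); split; last by rewrite chart_fun_heval.
exists 1%N, (fun=> 1), (fun _ _ => chart_poly e c f).
split; last by rewrite !big_ord1 mul1r.
move=> _ _ p pZ hp; apply/eqP.
by rewrite meval_chart_poly -heval_chart_eq0 // vf.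
Qed.

Lemma bimonoX p n : bimono k p ^+ n = bimono k (p.1 * n, p.2 * n)%N.
Proof. by rewrite /bimono exprZn -!exprM. Qed.

Lemma coef_bimonoM p f l j : (bimono k p * f)`_(p.2 + l)`_(p.1 + j) = f`_l`_j.
Proof.
rewrite /bimono -scalerAl coefZ [_ * f]mulrC coefMXn addKn ltnNge leq_addr /=.
by rewrite mulrC coefMXn addKn ltnNge leq_addr.
Qed.

(** The two chart units are [u] and [t]: the first product bounds the outer degree of [f], the
    second the inner degree of each row. *)
Lemma sect_shrink d e f : (d <= e)%N ->
  sect e e (chart_unit k r (false, true) ^+ (e - d) * f) ->
  sect e e (chart_unit k r (true, false) ^+ (e - d) * f) -> sect d d f.
Proof.
move=> de; rewrite /chart_unit /= !bimonoX /= mul0n mul1n muln0 addn0 mul1n => s1 s2 l j.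
rewrite negb_and -!leqNgt => /orP[h|h].
  by have := coef_bimonoM (0, e - d)%N f l j => <- /=; apply: s1; lia.
by have := coef_bimonoM (e - d, 0)%N f l j => <- /=; apply: s2; rewrite add0n; lia.
Qed.

(** Padding by the chart unit makes any polynomial a form of each large degree, so that one degree
    can serve all four charts. *)
Lemma chart_poly_surj c (F : {mpoly k[2]}) :
  exists e0, forall e, (e0 <= e)%N -> exists f, sect e e f /\ chart_poly e c f = F.
Proof.
elim/mpolyind: F => [|b m F _ _ [e0 IH]].
  by exists 0%N => e _; exists 0; split; [exact: supported0 | rewrite heval0].
exists (e0 + (m ord0 + m ord_max))%N => e he.
have [|f [sf ef]] := IH e; first by apply: leq_trans he; apply: leq_addr.
have he' : (m ord0 + m ord_max <= e)%N by apply: leq_trans he; apply: leq_addl.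
exists (b%:P *: local_monomial r c (0, 0) (m ord0) (m ord_max) (e - (m ord0 + m ord_max)) + f).
split.
  apply: supportedD => //; apply: supportedZ.
  by rewrite -{1 2}(subnKC he'); apply: sect_local_monomial.
rewrite hevalD hevalZ ef; congr (_ + _).
rewrite -{1 2}(subnKC he') heval_local_monomial !rmorph0 !subr0 -mul_mpolyC.
rewrite (mpolyXE_id _ m) big_ord_recl big_ord1.
by have -> : lift ord0 ord0 = ord_max :> 'I_2 by apply: val_inj.
Qed.

Lemma ord_ge_ideal_pow (Z : {fset hirzebruch k r}) p c m F :
    p \in Z -> in_chart c (hcoord p) -> ideal_pow (ideal_of Z c) m F ->
  ord_ge m (subst2 (@coef2 k) (coef2 (chart_coord r c (hcoord p)).1 + 'X%:P)
    (coef2 (chart_coord r c (hcoord p)).2 + 'X) F).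
Proof.
move=> pZ hp [n [h [f [If ->]]]]; set w := chart_coord _ _ _.
rewrite rmorph_sum; apply: ord_ge_sum => i _; rewrite rmorphM.
apply: ord_geMl; rewrite rmorph_prod; apply: ord_ge_prod => j; apply: ord_ge1.
rewrite -[RHS](If i j p pZ hp) -!horner_coef0.
rewrite -[LHS]/((horner_eval 0 \o horner_eval 0) _) [LHS]rmorph_mmap.
apply: eq_mmap => [b|l]; first by rewrite /= /horner_eval !hornerC.
rewrite /xy /= -/w; case: eqP => _; rewrite /horner_eval !hornerE //.
Qed.

(** The chart polynomials of [g] become forms [phi c] of one degree [e]. Their values at the generic
    point are [S c ^+ (e - d) * (u ^+ d * g)], and [S = 1] on the chart [(false, false)]; so each
    [phi c] is a power of the chart unit times the same polynomial, which the other charts force to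
    have degree [d]. *)
Lemma sect_of_has_section (Z : {fset hirzebruch k r}) m d : has_section Z m d ->
  exists f, [/\ sect d d f, f != 0 & forall p, p \in Z -> exists2 c, in_chart c (hcoord p) &
     ord_ge m (taylor r c (chart_coord r c (hcoord p)) d d f)].
Proof.
case=> g [g0 H0g].
have [F HF] := fin_all_exists H0g.
have [e0 He0] := fin_all_exists (fun c => chart_poly_surj c (F c)).
pose e := (d + \sum_c e0 c)%N.
have le_e c : (e0 c <= e)%N by rewrite /e (bigD1 c) //= addnCA leq_addr.
have de : (d <= e)%N by apply: leq_addr.
have [phi Hphi] := fin_all_exists (fun c => He0 c e (le_e c)).
have ssig c n : sect n n (chart_unit k r c ^+ n).
  by rewrite -[n in sect n n]mul1n; apply: sectX; apply: sect_chart_unit.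
pose S c := heval r K 1 1 (chart_unit k r c) gen.
have hsig c n : heval r K n n (chart_unit k r c ^+ n) gen = S c ^+ n.
  by have := hevalX K n gen (@sect_chart_unit k r c); rewrite mul1n.
have u0 : u != 0 := u_neq0.
have divS c n : divisor_eq k r (n * r.+1) n c * (S c ^+ n / u ^+ n) = 1.
  rewrite -hsig divisor_heval.
  by have := hevalX K n (chart_quad c (z c).1 (z c).2) (@sect_chart_unit k r c);
    rewrite mul1n heval_chart_unit_quad expr1n.
have S0 c : S c != 0.
  have := divS c 1%N; rewrite expr1; apply: contra_eq_neq => ->.
  by rewrite mul0r mulr0 eq_sym oner_neq0.
have phiE c : heval r K e e (phi c) gen = S c ^+ (e - d) * (u ^+ d * g).
  have [_ eF] := Hphi c; have [_ eg] := HF c.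
  by apply: (twist_solve de (S0 c) u0 (divS c d) (divS c e)); rewrite eg -eF chart_fun_heval.
have sphi c : sect e e (phi c) by case: (Hphi c).
have S1 : S (false, false) = 1 by rewrite /S heval_chart_unit /= expr1n mulr1.
have phi_sig c : phi c = chart_unit k r c ^+ (e - d) * phi (false, false).
  have sM := sectM (ssig c (e - d)%N) (sphi (false, false)).
  apply/eqP; rewrite -subr_eq0; apply/eqP.
  apply: (heval_generic_inj (s := (e - d + e)%N) (B := (e - d + e)%N)).
    apply: supportedD; last by apply: supportedN; exact: sM.
    move=> l j h; apply: (sphi c l j); apply: contra h => /andP[h1 h2].
    by apply/andP; split; lia.
  rewrite hevalD hevalN hevalM // hsig phiE S1 expr1n mul1r.
  rewrite (heval_generic_widen (s := e) (B := e)) ?leq_addl //.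
  by rewrite phiE subrr.
have sG : sect d d (phi (false, false)) by apply: (sect_shrink de); rewrite -phi_sig.
exists (phi (false, false)); split=> // [|p pZ].
  have := phiE (false, false); apply: contra_eq_neq => ->; rewrite heval0 eq_sym.
  apply: mulf_neq0; first exact/expf_neq0/S0.
  by apply: mulf_neq0 g0; apply: expf_neq0.
have [c hc] := valid_in_chart (hcoord_valid p); exists c => //.
have [IF _] := HF c; have [_ eF] := Hphi c.
have := ord_ge_ideal_pow pZ hc IF; rewrite -eF phi_sig.
have -> : chart_poly e c (chart_unit k r c ^+ (e - d) * phi (false, false)) =
    chart_poly d c (phi (false, false)).
  rewrite -[X in heval r mC X X](subnK de) hevalM //.
  have := hevalX mC (e - d) (chart_quad c X0 X1) (@sect_chart_unit k r c).
  by rewrite mul1n heval_chart_unit_quad expr1n => ->; rewrite mul1r.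
by rewrite subst2_heval.
Qed.

End Bridge.

Theorem theorem4p3 (k : closedFieldType) (r : nat) (hr : (1 <= r)%N)
    (Z : {fset hirzebruch k r}) (m : nat) (hm : (1 <= m)%N) :
  (initial_degree Z 1)%:R / (r + 2)%:R <= (initial_degree Z m)%:R / m%:R :> rat.
Proof.
have [_ min1] := initial_degreeP Z 1; have [sec_m _] := initial_degreeP Z m.
(* For initial degree 0 the left side is 0. Otherwise it is [e.+1], and minimality says that no
   nonzero section of eL vanishes on Z. *)
case: (initial_degree Z 1) min1 => [|e] min1; first by rewrite mul0r divr_ge0 ?ler0n.
have [G [sG G0 oG]] := sect_of_has_section sec_m.
rewrite ler_pdivrMr ?ltr0n ?addn2 // mulrAC ler_pdivlMr ?ltr0n // -!natrM ler_nat.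
rewrite mulnC -addn2 [X in (_ <= X)%N]mulnC mulnC.
pose p (i : 'I_(size (Z : seq (hirzebruch k r)))) := tnth (in_tuple (Z : seq _)) i.
have pZ i : p i \in Z by apply: mem_tnth.
apply: (@vanishing_bound k r _ (fun i => hcoord (p i)) e _ m G) => //.
- by move=> i; apply: hcoord_valid.
- move=> f sf vf; apply/eqP; apply: contraT => f0.
  suff /min1 : has_section Z 1 e by rewrite ltnn.
  apply: has_section_of_sect sf f0 _ => q qZ.
  by have /tnthP[i ->] : q \in in_tuple (Z : seq _) by []; apply: vf.
by move=> i; apply: oG.
Qed.
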